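(* Any Whitney's cusp $\psi:(\mathbb{R}^2,(x_0,y_0))\to(\mathbb{C},0)$ is radially equivalent to the standard function $(x,y)\mapsto x^3+xy+\mathrm{i}y$ at the origin.
   Context: Smooth means $C^\infty$; $\mathbb{C}$ is identified with $\mathbb{R}^2$ via $u+\mathrm{i}w=(u,w)$. A smooth map germ $\psi:(\mathbb{R}^2,(x_0,y_0))\to(\mathbb{C},0)$ is called a Whitney's cusp if it is right-left equivalent (under arbitrary local diffeomorphisms of $\mathbb{R}^2$ and $\mathbb{C}$, not necessarily radial) to the germ at the origin of $(x,y)\mapsto x^3+xy+\mathrm{i}y$. A radial transformation near $0\in\mathbb{C}$ is a local diffeomorphism $\tau:(\mathbb{C},0)\to(\mathbb{C},0)$, $\tau(u,w)=(U,W)$, sending each radial line (ray) $\{\theta=\mathrm{const.}\}$ to a radial line, where $u+\mathrm{i}w=re^{\mathrm{i}\theta}$; equivalently $U=\rho(u,w)(au+bw)$, $W=\rho(u,w)(cu+dw)$ with $\rho$ a positive function and $a,b,c,d\in\mathbb{R}$, $ad-bc\neq0$. Two germs $\psi:(\mathbb{R}^2,p)\to(\mathbb{C},0)$ and $\varphi:(\mathbb{R}^2,q)\to(\mathbb{C},0)$ are radially equivalent if $\psi\circ\sigma=\tau\circ\varphi$ for some local diffeomorphism $\sigma:(\mathbb{R}^2,q)\to(\mathbb{R}^2,p)$ and some local radial transformation $\tau$. *)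

(* Defs.v *)
From Stdlib Require Export Reals.
From Coquelicot Require Export Coquelicot.
Open Scope R_scope.

(** A map germ at [p] is represented by a total function on the plane, of which
    only the values near [p] matter.  The target plane is Coquelicot's [C],
    which is [R * R] by definition, [(u, w)] standing for [u + i w]. *)

(** [C^infty] on one common neighbourhood of [p]: there, all iterated partial
    derivatives, of every order and in every order of differentiation, exist
    and are continuous. *)
Definition smooth_fun_near (g : R -> R -> R) (p : R * R) : Prop :=
  locally_2d (fun x y => forall n : nat, ex_diff_n g n x y) (fst p) (snd p).

Definition smooth_near (f : R * R -> R * R) (p : R * R) : Prop :=
  smooth_fun_near (fun x y => fst (f (x, y))) p /\
  smooth_fun_near (fun x y => snd (f (x, y))) p.

Definition smooth_map_germ (f : R * R -> R * R) (p q : R * R) : Prop :=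
  smooth_near f p /\ f p = q.

Definition local_diffeo (f : R * R -> R * R) (p q : R * R) : Prop :=
  smooth_map_germ f p q /\
  exists g : R * R -> R * R,
    smooth_map_germ g q p /\
    locally p (fun z : R * R => g (f z) = z) /\
    locally q (fun z : R * R => f (g z) = z).

(** The open ray of argument [theta] issuing from the origin. *)
Definition on_ray (theta : R) (z : C) : Prop :=
  exists r : R, 0 < r /\ z = (r * cos theta, r * sin theta).

Definition radial_transformation (tau : C -> C) : Prop :=
  local_diffeo tau (0, 0) (0, 0) /\
  exists eps : posreal, forall theta : R, exists theta' : R,
    forall z : C, on_ray theta z -> Cmod z < eps -> on_ray theta' (tau z).

Definition right_left_equivalent
    (psi : R * R -> C) (p : R * R) (phi : R * R -> C) (q : R * R) : Prop :=
  exists (sigma : R * R -> R * R) (tau : C -> C),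
    local_diffeo sigma q p /\ local_diffeo tau (0, 0) (0, 0) /\
    locally q (fun z : R * R => psi (sigma z) = tau (phi z)).

Definition radially_equivalent
    (psi : R * R -> C) (p : R * R) (phi : R * R -> C) (q : R * R) : Prop :=
  exists (sigma : R * R -> R * R) (tau : C -> C),
    local_diffeo sigma q p /\ radial_transformation tau /\
    locally q (fun z : R * R => psi (sigma z) = tau (phi z)).

(** [(x, y) |-> x^3 + x y + i y] *)
Definition standard_cusp (p : R * R) : C :=
  (fst p ^ 3 + fst p * snd p, snd p).

Definition whitney_cusp (psi : R * R -> C) (p : R * R) : Prop :=
  smooth_map_germ psi p (0, 0) /\
  right_left_equivalent psi p standard_cusp (0, 0).

(* Main.v *)
Require Import Defs.
From Stdlib Require Import Lia Psatz Classical ClassicalEpsilon.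

(** Let [phi] be the standard cusp.  Its critical values form the curve
    [Delta x = (- 2 x^3, - 3 x^2)] ([cuspidal]).  A Whitney cusp is [tau o phi]
    up to a change of source coordinates, and has critical values
    [tau (Delta x)].  The proof looks for a radial map [T] sending [Delta] to
    [tau (Delta)] as a set.  Then [kappa = tau^-1 o T] preserves [Delta], it
    lifts to a source diffeomorphism [sigma] with [phi o sigma = kappa o phi],
    and [tau o phi o sigma = T o phi] is the claim.

    The radial map ([radial_matching]).  Take out the linear part of [tau].  Both
    curves are cusps with the same tangent line, and a ray near the negative
    vertical half-axis meets each of them once.  Hence [T] may be sought as
    [rho] times a shear, and the values of the positive factor [rho] on [Delta]
    are forced: [rho (Delta x) = K x].  Such a [K] comes from a smooth [rho] on
    the plane as soon as [K' 0 = 0], which the choice of the shear achieves: on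
    [Delta] the coordinates give [x^2] and [x^3], and every smooth function of
    [x] is [a (x^2) + x b (x^2)] with [a], [b] smooth near [0]
    ([even_odd_split]).  The last fact is Whitney's theorem on even functions;
    since [a] and [b] are needed on both sides of [0] while [x^2 >= 0], it rests
    on Borel's theorem ([borel]).

    The lift ([cuspidal_lift]).  The first component of [sigma] is a root of a
    cubic whose coefficients are those of [kappa o phi]; along the critical
    curve this root is double.  Working in the source, where the critical curve
    is smooth, one can divide twice by its equation ([hadamard_vanishing]);
    the quotient equation has a simple root, given by the implicit function
    theorem ([implicit_function]).

    Smoothness is handled through tangent maps ([Ck]), for which the chain rule
    is immediate, and is compared with iterated partial derivatives in
    [smooth_nearP]. *)

(** * Smooth maps between normed modules *)

Notation NM := (NormedModule R_AbsRing).
Notation RN := R_NormedModule.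
Notation "A ** B" := (prod_NormedModule R_AbsRing A B) (at level 40).
Notation R2 := (RN ** RN).

(** [ring] and [field] look the structure up in the type of the equation; these
    variants first replace the carrier of the normed module [R] by [R]. *)
Ltac show_R :=
  repeat match goal with
  | v : NormedModule.sort _ R_NormedModule |- _ => change R in v
  end;
  match goal with |- @eq _ ?a ?b => change (@eq R a b) end.
Ltac Rring := show_R; ring.
Ltac Rfield := show_R; field.

(** [C^k] regularity by iterated tangent maps: the derivative [D] is asked to be
    [C^(k-1)] as a function of the pair (point, direction).  With the direction
    as a variable, the tangent map of a composite is the composite of the
    tangent maps, so that the chain rule at every order is a plain induction,
    with no bases and no partial derivatives, and parameter spaces of any
    dimension are treated at once. *)
Fixpoint Ck (n : nat) : forall V W : NM, (V -> W) -> V -> Prop :=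
  match n with
  | O => fun V W f p => continuous f p
  | S k => fun V W f p =>
      exists D : V -> V -> W,
        locally p (fun q => filterdiff f (locally q) (D q)) /\
        forall v, Ck k (prod_NormedModule _ V V) W
                    (fun z => D (fst z) (snd z)) (p, v)
  end.
Arguments Ck n {V W} f p.

Lemma filterdiff_pair {V W X : NM} (f f' : V -> W) (g g' : V -> X) (p : V) :
  filterdiff f (locally p) f' -> filterdiff g (locally p) g' ->
  filterdiff (fun q => (f q, g q)) (locally p) (fun v => (f' v, g' v)).
Proof.
  intros Hf Hg.
  apply (filterdiff_comp_2 f g (fun a b => (a, b)) f' g' (fun a b => (a, b)) Hf Hg).
  apply (filterdiff_ext (fun z => z)); [now intros [a b]|].
  apply (filterdiff_ext_lin _ (fun z => z)); [apply filterdiff_id|now intros [a b]].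
Qed.

Lemma Ck_continuous n {V W : NM} (f : V -> W) p : Ck n f p -> continuous f p.
Proof.
  destruct n as [|n]; [easy|].
  intros (D & HD & _).
  apply filterdiff_continuous. exists (D p). now apply locally_singleton in HD.
Qed.

Lemma Ck_down n : forall {V W : NM} (f : V -> W) p, Ck (S n) f p -> Ck n f p.
Proof.
  induction n as [|n IH]; intros V W f p H.
  - now apply (Ck_continuous 1).
  - destruct H as (D & HD & HT). exists D; split; [easy|].
    intros v. now apply IH.
Qed.

Lemma Ck_ext_loc n : forall {V W : NM} (f g : V -> W) p,
  locally p (fun q => f q = g q) -> Ck n f p -> Ck n g p.
Proof.
  destruct n as [|n]; intros V W f g p E H.
  - simpl. now apply (continuous_ext_loc _ f).
  - destruct H as (D & HD & HT). exists D; split; [|easy].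
    apply locally_locally in E.
    generalize (filter_and _ _ E HD). apply filter_imp. intros q [e d].
    now apply (filterdiff_ext_locally f).
Qed.

Lemma Ck_ext n {V W : NM} (f g : V -> W) p :
  (forall q, f q = g q) -> Ck n f p -> Ck n g p.
Proof. intros E. apply Ck_ext_loc. now apply filter_forall. Qed.

Lemma continuous_pair {V W X : UniformSpace} (f : V -> W) (g : V -> X) p :
  continuous f p -> continuous g p -> continuous (fun q => (f q, g q)) p.
Proof.
  intros Hf Hg.
  apply (continuous_comp_2 f g (fun a b => (a, b))); auto.
  apply (continuous_ext (fun z => z)); [now intros [a b]|apply continuous_id].
Qed.

Lemma Ck_pair n : forall {V W X : NM} (f : V -> W) (g : V -> X) p,
  Ck n f p -> Ck n g p ->
  Ck n (W := prod_NormedModule _ W X) (fun q => (f q, g q)) p.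
Proof.
  induction n as [|n IH]; intros V W X f g p Hf Hg.
  - now apply continuous_pair.
  - destruct Hf as (D & HD & HT), Hg as (E & HE & HU).
    exists (fun q v => (D q v, E q v)); split.
    + generalize (filter_and _ _ HD HE). apply filter_imp. intros q [d e].
      now apply filterdiff_pair.
    + intros v. now apply (IH _ _ _ (fun z => D (fst z) (snd z))
                              (fun z => E (fst z) (snd z))).
Qed.

Lemma Ck_linear n : forall {V W : NM} (l : V -> W) p, is_linear l -> Ck n l p.
Proof.
  induction n as [|n IH]; intros V W l p Hl.
  - apply filterdiff_continuous. exists l. now apply filterdiff_linear.
  - exists (fun _ v => l v); split.
    + apply filter_forall. intros q. now apply filterdiff_linear.
    + intros v. apply (IH _ _ (fun z => l (snd z))).
      apply (is_linear_comp snd l); [apply is_linear_snd|easy].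
Qed.

Lemma Ck_const n : forall {V W : NM} (c : W) (p : V), Ck n (fun _ => c) p.
Proof.
  induction n as [|n IH]; intros V W c p.
  - apply continuous_const.
  - exists (fun _ _ => zero); split.
    + apply filter_forall. intros q. apply filterdiff_const.
    + intros v. apply IH.
Qed.

(** The tangent map of [f o g] is [(q, v) |-> Df (g q) (Dg q v)], again a
    composite, of regularity one less. *)
Lemma Ck_comp n : forall {V W X : NM} (g : V -> W) (f : W -> X) p,
  Ck n g p -> Ck n f (g p) -> Ck n (fun q => f (g q)) p.
Proof.
  induction n as [|n IH]; intros V W X g f p Hg Hf.
  - now apply continuous_comp.
  - pose proof (Ck_continuous _ _ _ Hg) as cg.
    pose proof (Ck_down _ _ _ Hg) as Hg'.
    destruct Hf as (D & HD & HT), Hg as (E & HE & HU).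
    exists (fun q v => D (g q) (E q v)); split.
    + specialize (cg _ HD). unfold filtermap in cg.
      generalize (filter_and _ _ cg HE). apply filter_imp. intros q [d e].
      now apply filterdiff_comp'.
    + intros v.
      apply (IH _ _ _ (fun z => (g (fst z), E (fst z) (snd z)))
                      (fun z => D (fst z) (snd z))).
      * apply (Ck_pair n (fun z => g (fst z)) (fun z => E (fst z) (snd z)));
          [|apply HU].
        apply (IH _ _ _ fst g); [|exact Hg'].
        apply Ck_linear, is_linear_fst.
      * apply HT.
Qed.

Lemma Ck_plus n {V : NM} (f g : V -> R) p :
  Ck n (W := R_NormedModule) f p -> Ck n (W := R_NormedModule) g p ->
  Ck n (W := R_NormedModule) (fun q => f q + g q) p.
Proof.
  intros Hf Hg.
  apply (Ck_comp n (fun q => (f q, g q)) (fun z : R * R => plus (fst z) (snd z))).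
  - now apply Ck_pair.
  - apply Ck_linear. exact (is_linear_plus (V := R_NormedModule)).
Qed.

Lemma Ck_mult n : forall {V : NM} (f g : V -> R) p,
  Ck n (W := R_NormedModule) f p -> Ck n (W := R_NormedModule) g p ->
  Ck n (W := R_NormedModule) (fun q => f q * g q) p.
Proof.
  induction n as [|n IH]; intros V f g p Hf Hg.
  - now apply (continuous_mult (K := R_AbsRing) f g).
  - pose proof (Ck_down _ _ _ Hg) as Hg'. pose proof (Ck_down _ _ _ Hf) as Hf'.
    destruct Hf as (D & HD & HT), Hg as (E & HE & HU).
    exists (fun q v => D q v * g q + f q * E q v); split.
    + generalize (filter_and _ _ HD HE). apply filter_imp. intros q [d e].
      apply (filterdiff_mult_fct (K := R_AbsRing) f g q); auto.
      intros; apply Rmult_comm.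
    + intros v. apply (Ck_plus n (fun z => D (fst z) (snd z) * g (fst z))
        (fun z => f (fst z) * E (fst z) (snd z))); apply IH; auto.
      * apply (Ck_comp n fst g); [apply Ck_linear, is_linear_fst|easy].
      * apply (Ck_comp n fst f); [apply Ck_linear, is_linear_fst|easy].
Qed.

(** The derivative [- v / y^2] is a polynomial in [v] and [/ y], so each order
    follows from the previous one. *)
Lemma Ck_Rinv n : forall x : R, x <> 0 ->
  Ck n (V := R_NormedModule) (W := R_NormedModule) Rinv x.
Proof.
  assert (nz : forall x : R, x <> 0 -> locally x (fun y : R => y <> 0)).
  { intros x Hx. exists (mkposreal _ (Rabs_pos_lt _ Hx)). intros y Hy ->.
    unfold ball in Hy; simpl in Hy. unfold AbsRing_ball, abs, minus, plus, opp in Hy; simpl in Hy.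
    rewrite Rplus_0_l, Rabs_Ropp in Hy. lra. }
  induction n as [|n IH]; intros x Hx.
  - now apply continuous_Rinv.
  - exists (fun y v => - (v * (/ y * / y))); split.
    + generalize (nz x Hx). apply filter_imp. intros y Hy.
      assert (d : is_derive Rinv y (- (/ y * / y))).
      { auto_derive; [easy|field; easy]. }
      apply (filterdiff_ext_lin _ _ _ d). intros v.
      unfold scal; simpl; unfold mult; simpl. ring.
    + intros v.
      apply (Ck_ext n (fun z : R * R => (-1) * (snd z * (/ fst z * / fst z)))).
      { intros z. change (@eq R (-1 * (snd z * (/ fst z * / fst z))) (- (snd z * (/ fst z * / fst z)))). ring. }
      apply (Ck_mult n (V := prod_NormedModule _ R_NormedModule R_NormedModule)); [apply Ck_const|].
      apply Ck_mult; [apply Ck_linear, is_linear_snd|].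
      apply Ck_mult; apply (Ck_comp n fst Rinv); auto; apply Ck_linear, is_linear_fst.
Qed.

Definition smooth_pt {V W : NM} (f : V -> W) (p : V) : Prop := forall n, Ck n f p.
(** The neighbourhood does not depend on the order of differentiation, as in
    [smooth_fun_near]. *)
Definition smooth_at {V W : NM} (f : V -> W) (p : V) : Prop :=
  locally p (smooth_pt f).

Lemma smooth_at_pt {V W : NM} (f : V -> W) p : smooth_at f p -> smooth_pt f p.
Proof. apply locally_singleton. Qed.

Lemma smooth_at_continuous {V W : NM} (f : V -> W) p : smooth_at f p -> continuous f p.
Proof. intros H. now apply (Ck_continuous 0), smooth_at_pt. Qed.

Lemma smooth_at_near {V W : NM} (f : V -> W) p :
  smooth_at f p -> locally p (smooth_at f).
Proof. apply locally_locally. Qed.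

Lemma smooth_at_ext {V W : NM} (f g : V -> W) p :
  locally p (fun q => f q = g q) -> smooth_at f p -> smooth_at g p.
Proof.
  intros E H. apply locally_locally in E.
  unfold smooth_at in *; generalize (filter_and _ _ E H). apply @filter_imp; try apply locally_filter. intros q [e h] n.
  apply (Ck_ext_loc n f); auto.
Qed.

Lemma smooth_at_const {V W : NM} (c : W) (p : V) : smooth_at (fun _ => c) p.
Proof. unfold smooth_at; apply filter_forall; intros q n. apply Ck_const. Qed.
Lemma smooth_at_linear {V W : NM} (l : V -> W) (p : V) : is_linear l -> smooth_at l p.
Proof. intros H. unfold smooth_at; apply filter_forall; intros q n. now apply Ck_linear. Qed.
Lemma smooth_at_comp {V W X : NM} (g : V -> W) (f : W -> X) p :
  smooth_at g p -> smooth_at f (g p) -> smooth_at (fun q => f (g q)) p.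
Proof.
  intros Hg Hf. pose proof (smooth_at_continuous _ _ Hg _ Hf) as Hf'.
  unfold smooth_at in *; generalize (filter_and _ _ Hg Hf'). apply @filter_imp; try apply locally_filter. intros q [a b] n.
  apply Ck_comp; auto.
Qed.
Lemma smooth_at_id {V : NM} (p : V) : smooth_at (fun q : V => q) p.
Proof. apply smooth_at_linear, is_linear_id. Qed.
Lemma smooth_at_fst {V W X : NM} (f : V -> W ** X) p :
  smooth_at f p -> smooth_at (fun q => fst (f q)) p.
Proof. intros H. apply (smooth_at_comp f fst); auto. apply smooth_at_linear, is_linear_fst. Qed.
Lemma smooth_at_snd {V W X : NM} (f : V -> W ** X) p :
  smooth_at f p -> smooth_at (fun q => snd (f q)) p.
Proof. intros H. apply (smooth_at_comp f snd); auto. apply smooth_at_linear, is_linear_snd. Qed.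
Lemma smooth_at_pair {V W X : NM} (f : V -> W) (g : V -> X) p :
  smooth_at f p -> smooth_at g p ->
  smooth_at (W := W ** X) (fun q => (f q, g q)) p.
Proof. intros H K. unfold smooth_at in *; generalize (filter_and _ _ H K). apply @filter_imp; try apply locally_filter.
  intros q [a b] n. apply Ck_pair; auto. Qed.
Lemma smooth_at_plus {V : NM} (f g : V -> R) p :
  smooth_at (W := RN) f p -> smooth_at (W := RN) g p ->
  smooth_at (W := RN) (fun q => f q + g q) p.
Proof. intros H K. unfold smooth_at in *; generalize (filter_and _ _ H K). apply @filter_imp; try apply locally_filter.
  intros q [a b] n. apply Ck_plus; auto. Qed.
Lemma smooth_at_mult {V : NM} (f g : V -> R) p :
  smooth_at (W := RN) f p -> smooth_at (W := RN) g p ->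
  smooth_at (W := RN) (fun q => f q * g q) p.
Proof. intros H K. unfold smooth_at in *; generalize (filter_and _ _ H K). apply @filter_imp; try apply locally_filter.
  intros q [a b] n. apply Ck_mult; auto. Qed.
Lemma smooth_at_opp {V : NM} (f : V -> R) p :
  smooth_at (W := RN) f p -> smooth_at (W := RN) (fun q => - f q) p.
Proof. intros H. apply (smooth_at_ext (W := RN) (fun q => (-1) * f q)).
  { apply filter_forall. intros q. change (@eq R (-1 * f q) (- f q)). ring. }
  apply smooth_at_mult; auto. apply smooth_at_const. Qed.
Lemma smooth_at_minus {V : NM} (f g : V -> R) p :
  smooth_at (W := RN) f p -> smooth_at (W := RN) g p ->
  smooth_at (W := RN) (fun q => f q - g q) p.
Proof. intros H K. apply smooth_at_plus; auto. now apply smooth_at_opp. Qed.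
Lemma smooth_at_inv {V : NM} (f : V -> R) p :
  smooth_at (W := RN) f p -> f p <> 0 -> smooth_at (W := RN) (fun q => / f q) p.
Proof.
  intros H nz. apply (smooth_at_comp (W := RN) f Rinv); auto.
  assert (N : locally (f p) (fun y : R => y <> 0)).
  { exists (mkposreal _ (Rabs_pos_lt _ nz)). intros y Hy ->.
    unfold ball in Hy; simpl in Hy. unfold AbsRing_ball, abs, minus, plus, opp in Hy; simpl in Hy.
    rewrite Rplus_0_l, Rabs_Ropp in Hy. lra. }
  unfold smooth_at; revert N. apply @filter_imp; try apply locally_filter. intros y Hy n. now apply Ck_Rinv.
Qed.
Lemma smooth_at_div {V : NM} (f g : V -> R) p :
  smooth_at (W := RN) f p -> smooth_at (W := RN) g p -> g p <> 0 ->
  smooth_at (W := RN) (fun q => f q / g q) p.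
Proof. intros H K nz. apply smooth_at_mult; auto. now apply smooth_at_inv. Qed.
Lemma smooth_at_pow {V : NM} (f : V -> R) k p :
  smooth_at (W := RN) f p -> smooth_at (W := RN) (fun q => f q ^ k) p.
Proof.
  intros H. induction k as [|k IH]; simpl; [apply smooth_at_const|].
  now apply smooth_at_mult.
Qed.

(** * Comparison with iterated partial derivatives *)

Lemma is_derive_along {V W : NM} (f : V -> W) (L : V -> W) (c : R -> V) (t : R) (v : V) :
  filterdiff f (locally (c t)) L -> is_derive c t v ->
  is_derive (fun s => f (c s)) t (L v).
Proof.
  intros Hf Hc. unfold is_derive.
  apply (filterdiff_ext_lin _ _ _ (filterdiff_comp' c f t _ L Hc Hf)).
  intros y. apply linear_scal. apply Hf.
Qed.

Lemma is_derive_pair_l (x y : R) :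
  is_derive (V := RN ** RN) (fun z => (z, y)) x (1, 0).
Proof.
  unfold is_derive.
  apply (filterdiff_ext_lin _ (fun v : R => (v, 0))).
  - apply (filterdiff_pair (V := RN) (W := RN) (X := RN) (fun z => z) (fun v => v) (fun _ => y) (fun _ => zero)).
    + apply filterdiff_id.
    + apply filterdiff_const.
  - intros v. unfold scal; simpl; unfold prod_scal, scal; simpl; unfold mult; simpl.
    f_equal; Rring.
Qed.

Lemma is_derive_pair_r (x y : R) :
  is_derive (V := RN ** RN) (fun z => (x, z)) y (0, 1).
Proof.
  unfold is_derive.
  apply (filterdiff_ext_lin _ (fun v : R => (0, v))).
  - apply (filterdiff_pair (V := RN) (W := RN) (X := RN) (fun _ => x) (fun _ => zero) (fun z => z) (fun v => v)).
    + apply filterdiff_const.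
    + apply filterdiff_id.
  - intros v. unfold scal; simpl; unfold prod_scal, scal; simpl; unfold mult; simpl.
    f_equal; Rring.
Qed.

Lemma Ck_slice n {V W : NM} (D : V -> V -> W) (p v : V) :
  Ck n (V := V ** V) (fun z => D (fst z) (snd z)) (p, v) -> Ck n (fun q => D q v) p.
Proof.
  intros H. apply (Ck_comp n (W := V ** V) (fun q => (q, v)) (fun z => D (fst z) (snd z)) p); [|exact H].
  apply Ck_pair; [apply Ck_linear, is_linear_id|apply Ck_const].
Qed.

(** A partial derivative is the tangent map with a frozen direction. *)
Lemma smooth_pt_partials (f : R * R -> R) (p : R * R) :
  smooth_pt (V := RN ** RN) (W := RN) f p ->
  ex_derive (fun z => f (z, snd p)) (fst p) /\
  ex_derive (fun z => f (fst p, z)) (snd p) /\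
  smooth_pt (V := RN ** RN) (W := RN) (fun q => Derive (fun z => f (z, snd q)) (fst q)) p /\
  smooth_pt (V := RN ** RN) (W := RN) (fun q => Derive (fun z => f (fst q, z)) (snd q)) p.
Proof.
  intros H.
  assert (D1 : forall (D : R * R -> R * R -> R) q,
    filterdiff (U := RN ** RN) (V := RN) f (locally q) (D q) ->
    is_derive (fun z => f (z, snd q)) (fst q) (D q (1, 0)) /\
    is_derive (fun z => f (fst q, z)) (snd q) (D q (0, 1))).
  { intros D [x y] d; simpl; split.
    - apply (is_derive_along (V := RN ** RN) f (D (x, y)) (fun z => (z, y))); [exact d|].
      apply is_derive_pair_l.
    - apply (is_derive_along (V := RN ** RN) f (D (x, y)) (fun z => (x, z))); [exact d|].
      apply is_derive_pair_r. }
  repeat split.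
  - destruct (H 1%nat) as (D & HD & _). apply locally_singleton in HD.
    eexists. apply (D1 D). exact HD.
  - destruct (H 1%nat) as (D & HD & _). apply locally_singleton in HD.
    eexists. apply (D1 D). exact HD.
  - intros n. destruct (H (S n)) as (D & HD & HT).
    apply (Ck_ext_loc n (V := RN ** RN) (W := RN) (fun q => D q (1, 0))).
    + revert HD. apply filter_imp. intros q d. symmetry.
      apply is_derive_unique. now apply (D1 D).
    + apply (Ck_slice n (V := RN ** RN)). apply HT.
  - intros n. destruct (H (S n)) as (D & HD & HT).
    apply (Ck_ext_loc n (V := RN ** RN) (W := RN) (fun q => D q (0, 1))).
    + revert HD. apply filter_imp. intros q d. symmetry.
      apply is_derive_unique. now apply (D1 D).
    + apply (Ck_slice n (V := RN ** RN)). apply HT.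
Qed.

Lemma smooth_pt_ex_diff_n n : forall (f : R -> R -> R) (x y : R),
  smooth_pt (V := RN ** RN) (W := RN) (fun q => f (fst q) (snd q)) (x, y) ->
  ex_diff_n f n x y.
Proof.
  induction n as [|n IH]; intros f x y H.
  - split; [|easy]. apply continuity_2d_pt_filterlim. exact (H 0%nat).
  - destruct (smooth_pt_partials _ _ H) as (a & b & c & d). simpl in *.
    split; [apply continuity_2d_pt_filterlim; exact (H 0%nat)|].
    split; [exact a|]. split; [exact b|]. split; apply IH; assumption.
Qed.

(** Continuity of the partial derivatives nearby gives total differentiability,
    and the total derivative is an explicit expression in partial derivatives,
    to which the induction hypothesis applies. *)
Lemma ex_diff_n_Ck n : forall (f : R -> R -> R) (p : R * R),
  locally p (fun q => forall m, ex_diff_n f m (fst q) (snd q)) ->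
  Ck n (V := RN ** RN) (W := RN) (fun q => f (fst q) (snd q)) p.
Proof.
  induction n as [|n IH]; intros f [x y] H.
  - apply locally_singleton in H. specialize (H 0%nat).
    apply continuity_2d_pt_filterlim. apply H.
  - exists (fun q v => fst v * Derive (fun z => f z (snd q)) (fst q) +
                       snd v * Derive (fun z => f (fst q) z) (snd q)).
    split.
    + apply locally_locally in H. revert H. apply filter_imp. intros [a b] H.
      apply (is_derive_filterdiff f a b
               (fun u v => Derive (fun z => f z v) u) (Derive (fun z => f a z) b)).
      * revert H. apply filter_imp. intros q h. specialize (h 1%nat).
        apply Derive_correct. apply h.
      * apply locally_singleton in H. specialize (H 1%nat).
        apply Derive_correct. apply H.
      * apply locally_singleton in H. specialize (H 1%nat).
        apply (proj1 (continuity_2d_pt_filterlim (fun u v => Derive (fun z => f z v) u) a b)). apply H.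
    + intros v.
      pose (F1 := fun u v => Derive (fun z => f z v) u).
      pose (F2 := fun u v => Derive (fun z => f u z) v).
      apply (Ck_plus n (V := (RN ** RN) ** (RN ** RN))
               (fun z => fst (snd z) * F1 (fst (fst z)) (snd (fst z)))
               (fun z => snd (snd z) * F2 (fst (fst z)) (snd (fst z)))).
      * apply (Ck_mult n (V := (RN ** RN) ** (RN ** RN))).
        { apply Ck_linear.
          apply (is_linear_comp (V := RN ** RN) (W := RN) snd fst); [apply is_linear_snd|apply is_linear_fst]. }
        apply (Ck_comp n (V := (RN ** RN) ** (RN ** RN)) (W := RN ** RN) fst
                (fun q => F1 (fst q) (snd q))); [apply Ck_linear, is_linear_fst|].
        apply IH. revert H. apply filter_imp. intros q h m. apply (h (S m)).
      * apply (Ck_mult n (V := (RN ** RN) ** (RN ** RN))).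
        { apply Ck_linear.
          apply (is_linear_comp (V := RN ** RN) (W := RN) snd snd); [apply is_linear_snd|apply is_linear_snd]. }
        apply (Ck_comp n (V := (RN ** RN) ** (RN ** RN)) (W := RN ** RN) fst
                (fun q => F2 (fst q) (snd q))); [apply Ck_linear, is_linear_fst|].
        apply IH. revert H. apply filter_imp. intros q h m. apply (h (S m)).
Qed.

Lemma smooth_fun_nearP (f : R * R -> R) (p : R * R) :
  smooth_fun_near (fun x y => f (x, y)) p <-> smooth_at (V := RN ** RN) (W := RN) f p.
Proof.
  unfold smooth_fun_near, smooth_at. split; intros H.
  - apply locally_2d_locally in H. destruct p as [x y]. simpl in H.
    apply locally_locally in H. revert H. apply filter_imp. intros q h n.
    apply (Ck_ext n (V := RN ** RN) (W := RN) (fun q => f (fst q, snd q))); [now intros []|].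
    apply (ex_diff_n_Ck n (fun x y => f (x, y))). exact h.
  - apply locally_2d_locally. destruct p as [x y]. simpl.
    revert H. apply filter_imp. intros [a b] h n. simpl.
    apply smooth_pt_ex_diff_n. intros m.
    apply (Ck_ext m (V := RN ** RN) (W := RN) f); [now intros []|]. apply h.
Qed.

Lemma smooth_nearP (f : R * R -> R * R) (p : R * R) :
  smooth_near f p <-> smooth_at (V := RN ** RN) (W := RN ** RN) f p.
Proof.
  unfold smooth_near. rewrite (smooth_fun_nearP (fun q => fst (f q))), (smooth_fun_nearP (fun q => snd (f q))).
  split.
  - intros [a b].
    apply (smooth_at_ext (V := RN ** RN) (W := RN ** RN) (fun q => (fst (f q), snd (f q)))).
    + apply filter_forall. intros q. now destruct (f q).
    + now apply smooth_at_pair.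
  - intros H. split; [now apply smooth_at_fst|now apply smooth_at_snd].
Qed.

(** * The implicit function theorem *)

Lemma continuous_pos_near {V : UniformSpace} (f : V -> R) p :
  continuous f p -> 0 < f p -> locally p (fun q => 0 < f q).
Proof. intros Hf H. exact (Hf _ (open_gt 0 (f p) H)). Qed.

Lemma norm_pair_le {V : NM} (v : V) (k : R) :
  norm (K := R_AbsRing) (V := V ** RN) (v, k) <= 2 * (norm v + Rabs k).
Proof.
  destruct (norm_prod (U := V) (V := RN) v k) as [_ H].
  apply (Rle_trans _ _ _ H).
  assert (0 <= norm v) by apply norm_ge_0.
  assert (0 <= Rabs k) by apply Rabs_pos.
  change (norm k) with (Rabs k).
  assert (sqrt 2 <= 2).
  { rewrite <- (sqrt_square 2) at 2; [|lra]. apply sqrt_le_1; lra. }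
  assert (0 <= sqrt 2) by apply sqrt_pos.
  unfold Rmax. destruct (Rle_dec _ _); nra.
Qed.

(** Since [F] vanishes on the graph of [h], the increment [k] of [h] satisfies
    [|c k + DF (v, 0)| <= delta (|v| + |k|)] with [c] the vertical derivative;
    this first bounds [|k|] by a multiple of [|v|] and then gives the
    expansion of [h]. *)
Lemma implicit_filterdiff {V : NM} (F : V * R -> R) (h : V -> R) (q : V) (DF : V * R -> R) :
  filterdiff (U := V ** RN) (V := RN) F (locally (q, h q)) DF ->
  DF (zero, 1) <> 0 ->
  continuous h q ->
  locally q (fun x => F (x, h x) = 0) ->
  filterdiff (V := RN) h (locally q) (fun v => - (DF (v, 0) / DF (zero, 1))).
Proof.
  intros HF nz ch E.
  set (c := DF (zero, 1)) in *.
  destruct HF as [linF domF].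
  assert (linL : is_linear (V := RN) (fun v => - (DF (v, 0) / c))).
  { apply (is_linear_comp (V := RN) (W := RN) (fun v => DF (v, 0)) (fun y => - (y / c))).
    - apply (is_linear_comp (V := V ** RN) (W := RN) (fun v => (v, 0)) DF); [|exact linF].
      apply (is_linear_prod (V := RN) (fun v => v) (fun _ => 0)); [apply is_linear_id|].
      exact (is_linear_zero (U := V) (V := RN)).
    - split.
      + intros x y. unfold plus; simpl. Rfield. exact nz.
      + intros x y. unfold scal; simpl; unfold mult; simpl. Rfield. exact nz.
      + exists (/ Rabs c). split; [apply Rinv_0_lt_compat, Rabs_pos_lt, nz|].
        intros y. unfold norm; simpl; unfold abs; simpl.
        rewrite Rabs_Ropp. unfold Rdiv. rewrite Rabs_mult, Rabs_inv; lra. }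
  split; [exact linL|].
  intros x Hx. apply is_filter_lim_locally_unique in Hx. subst x.
  intros eps.
  destruct (linear_norm _ linL) as (M & HM & HL).
  (* [d <= 1/2] absorbs [|k|] in the right-hand side, which leaves
     [|k| <= (2 M + 1) |v|]; the other bound then yields [eps |v|]. *)
  pose (d := Rmin (1/2) (eps / (2 * M + 2))).
  assert (d0 : 0 < d).
  { apply Rmin_pos; [lra|]. apply Rdiv_lt_0_compat; [apply cond_pos|lra]. }
  assert (c0 : 0 < Rabs c) by now apply Rabs_pos_lt.
  assert (e0 : 0 < Rabs c * d / 2) by nra.
  specialize (domF (q, h q) (fun P H => H) (mkposreal _ e0)). simpl in domF.
  assert (cpair : continuous (fun x => (x, h x)) q).
  { apply continuous_pair; [apply continuous_id|exact ch]. }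
  specialize (cpair _ domF). unfold filtermap in cpair.
  assert (Eq : F (q, h q) = 0) by exact (locally_singleton _ _ E).
  generalize (filter_and _ _ cpair E). apply filter_imp. clear cpair domF E.
  intros y [H Ey].
  rewrite Ey, Eq in H.
  set (k := h y - h q).
  change (minus (h y) (h q)) with k.
  assert (exists v : V, v = minus y q) as [v Ev] by now exists (minus y q).
  change (minus (y, h y) (q, h q)) with (minus y q : V, k) in H.
  rewrite <- Ev in H |- *.
  assert (Dvk : DF (v, k) = DF (v, 0) + k * c).
  { replace (v, k) with (plus (G := V ** RN) (v, 0) (scal k (zero : V, 1 : RN))).
    2: { change ((plus v (scal k zero), 0 + k * 1) = (v, k)).
         rewrite scal_zero_r, plus_zero_r. f_equal. ring. }
    rewrite (linear_plus _ linF), (linear_scal _ linF). reflexivity. }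
  rewrite Dvk in H.
  specialize (HL v).
  pose proof (norm_pair_le v k) as Hn.
  set (N := norm v) in *.
  assert (N0 : 0 <= N) by apply norm_ge_0.
  unfold norm at 1 in H; simpl in H. unfold abs, minus, plus, opp in H; simpl in H.
  unfold norm in HL at 1; simpl in HL; unfold abs in HL; simpl in HL.
  change (norm (minus k (- (DF (v, 0) / c)))) with (Rabs (k + - - (DF (v, 0) / c))).
  set (L := - (DF (v, 0) / c)) in *.
  assert (HD : DF (v, 0) = - (c * L)) by (unfold L; Rfield; exact nz).
  rewrite HD in H.
  replace (0 + - 0 + - (- (c * L) + k * c)) with (- (c * (k - L))) in H by ring.
  rewrite Rabs_Ropp, Rabs_mult in H.
  replace (k + - L) with (k - L) by ring.
  assert (H1 : Rabs (k - L) <= d * (N + Rabs k)).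
  { apply (Rmult_le_reg_l (Rabs c)); [easy|]. 
    apply (Rle_trans _ _ _ H). nra. }
  assert (H2 : Rabs k <= Rabs (k - L) + Rabs L).
  { replace k with ((k - L) + L) at 1 by ring. apply Rabs_triang. }
  assert (d1 : d <= 1/2) by apply Rmin_l.
  assert (d2 : d * (2 * M + 2) <= eps).
  { apply (Rle_trans _ (eps / (2 * M + 2) * (2 * M + 2))).
    - apply Rmult_le_compat_r; [lra|apply Rmin_r].
    - right. field. lra. }
  assert (0 <= Rabs k) by apply Rabs_pos.
  assert (H3 : Rabs k <= (2 * M + 1) * N) by nra.
  apply (Rle_trans _ _ _ H1).
  apply (Rle_trans _ (d * ((2 * M + 2) * N))).
  - apply Rmult_le_compat_l; lra.
  - rewrite <- Rmult_assoc. apply Rmult_le_compat_r; lra.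
Qed.

Lemma is_derive_last {V : NM} (F : V * R -> R) (p : V) (z : R) (DF : V * R -> R) :
  filterdiff (U := V ** RN) (V := RN) F (locally (p, z)) DF ->
  is_derive (fun t => F (p, t)) z (DF (zero, 1)).
Proof.
  intros H. apply (is_derive_along (V := V ** RN) (W := RN) F DF (fun t => (p, t))); [exact H|].
  unfold is_derive.
  apply (filterdiff_ext_lin _ (fun v : R => (zero, v))).
  - apply (filterdiff_pair (V := RN) (X := RN) (fun _ => p) (fun _ => zero) (fun z => z) (fun v => v)).
    + apply filterdiff_const.
    + apply filterdiff_id.
  - intros v. change ((zero : V, v) = (scal v zero, v * 1)).
    rewrite scal_zero_r. f_equal. Rring.
Qed.

(** Bootstrap: the tangent map of [h] is an expression in [h] and in the tangent
    map of [F], hence as regular as [h] is already known to be. *)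
Lemma implicit_smooth_pt {V : NM} (F : V * R -> R) (h : V -> R) (p : V) (l : R) :
  smooth_pt (V := V ** RN) (W := RN) F (p, h p) ->
  locally p (continuous h) ->
  locally p (fun q => F (q, h q) = 0) ->
  is_derive (fun z => F (p, z)) (h p) l -> l <> 0 ->
  smooth_pt (W := RN) h p.
Proof.
  intros HF ch E dl nz n. induction n as [|n IH].
  - now apply locally_singleton in ch.
  - destruct (HF (S n)) as (D & HD & HT).
    assert (nzD : D (p, h p) (zero, 1) <> 0).
    { apply locally_singleton, is_derive_last in HD.
      apply is_derive_unique in HD. apply is_derive_unique in dl.
      rewrite <- HD, dl. exact nz. }
    exists (fun q v => - (D (q, h q) (v, 0) / D (q, h q) (zero, 1))).
    assert (cpair : continuous (fun x => (x, h x)) p).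
    { apply continuous_pair; [apply continuous_id|]. now apply locally_singleton in ch. }
    assert (cD : continuous (fun q => D (q, h q) (zero, 1)) p).
    { apply (continuous_comp (fun q => (q, h q)) (fun w => D w (zero, 1))); [easy|].
      apply (Ck_continuous n (V := V ** RN) (W := RN)).
      apply (Ck_slice n (V := V ** RN) (W := RN)). apply HT. }
    split.
    + pose proof (cpair _ HD) as HD'.
      pose proof (cD _ (open_neq 0 _ nzD)) as nz'.
      unfold filtermap in HD', nz'.
      apply locally_locally in E.
      generalize (filter_and _ _ (filter_and _ _ HD' nz') (filter_and _ _ ch E)).
      apply filter_imp. intros q [[a b] [c e]].
      now apply (implicit_filterdiff F h q).
    + intros v.
      assert (Hh : Ck n (V := V ** V) (W := V ** RN) (fun z => (fst z, h (fst z))) (p, v)).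
      { apply (Ck_comp n (V := V ** V) (W := V) (X := V ** RN) fst (fun q => (q, h q))).
        - apply Ck_linear, is_linear_fst.
        - apply (Ck_pair n (W := V) (X := RN) (fun q => q) h); [apply Ck_linear, is_linear_id|exact IH]. }
      apply (Ck_ext n (V := V ** V) (W := RN)
        (fun z => (-1) * (D (fst z, h (fst z)) (snd z, 0) * / D (fst z, h (fst z)) (zero, 1)))).
      { intros z. unfold Rdiv. Rring. }
      apply (Ck_mult n (V := V ** V)); [apply Ck_const|].
      apply (Ck_mult n (V := V ** V)).
      * apply (Ck_comp n (V := V ** V) (W := (V ** RN) ** (V ** RN)) (X := RN)
                 (fun z => ((fst z, h (fst z)), (snd z, 0))) (fun w => D (fst w) (snd w))); [|apply HT].
        apply (Ck_pair n (V := V ** V) (W := V ** RN) (X := V ** RN)); [exact Hh|].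
        apply (Ck_pair n (V := V ** V) (W := V) (X := RN) snd); [|apply Ck_const].
        apply Ck_linear, is_linear_snd.
      * apply (Ck_comp n (V := V ** V) (W := RN) (X := RN)
           (fun z => D (fst z, h (fst z)) (zero, 1)) Rinv); [|now apply Ck_Rinv].
        apply (Ck_comp n (V := V ** V) (W := V ** RN) (X := RN)
                 (fun z => (fst z, h (fst z))) (fun w => D w (zero, 1))); [exact Hh|].
        apply (Ck_slice n (V := V ** RN) (W := RN)). apply HT.
Qed.

(** Near the base point [F] increases strictly in its last variable, so a sign
    change between [z0 - r/2] and [z0 + r/2] isolates exactly one root [h p],
    and sign changes at [h p - e] and [h p + e] make it continuous. *)
Lemma implicit_function_pos {V : NM} (F : V * R -> R) (p0 : V) (z0 l : R) :
  smooth_at (V := V ** RN) (W := RN) F (p0, z0) ->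
  F (p0, z0) = 0 -> is_derive (fun z => F (p0, z)) z0 l -> 0 < l ->
  exists h : V -> R, smooth_at (W := RN) h p0 /\ h p0 = z0 /\
    locally (p0, z0) (fun w => F w = 0 <-> snd w = h (fst w)).
Proof.
  intros HF F0 dl l0.
  destruct (smooth_at_pt _ _ HF 1%nat) as (D & HD & HT).
  assert (posD : 0 < D (p0, z0) (zero, 1)).
  { pose proof (is_derive_last _ _ _ _ (locally_singleton _ _ HD)) as d.
    apply is_derive_unique in d. apply is_derive_unique in dl. rewrite <- d, dl. exact l0. }
  assert (cD : continuous (fun w => D w (zero, 1)) (p0, z0)).
  { apply (Ck_continuous 0 (V := V ** RN) (W := RN)).
    apply (Ck_slice 0 (V := V ** RN) (W := RN)). apply HT. }
  pose proof (continuous_pos_near _ _ cD posD) as pD.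
  destruct (filter_and _ _ HF (filter_and _ _ HD pD)) as [r Hr].
  assert (Hr' : forall p z, ball p0 r p -> Rabs (z - z0) < r ->
     smooth_pt (V := V ** RN) (W := RN) F (p, z) /\
     is_derive (fun t => F (p, t)) z (D (p, z) (zero, 1)) /\ 0 < D (p, z) (zero, 1)).
  { intros p z Hp Hz. destruct (Hr (p, z)) as (a & b & c); [split; [exact Hp|exact Hz]|].
    split; [exact a|]. split; [|exact c]. now apply is_derive_last. }
  clear Hr HF HD HT cD pD posD dl l0.
  assert (cz : forall p z, ball p0 r p -> Rabs (z - z0) < r -> continuity_pt (fun t => F (p, t)) z).
  { intros p z Hp Hz. apply continuity_pt_filterlim.
    apply (ex_derive_continuous (fun t => F (p, t)) z). eexists. now apply Hr'. }
  assert (mono : forall p z1 z2, ball p0 r p -> Rabs (z1 - z0) < r -> Rabs (z2 - z0) < r ->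
      z1 < z2 -> F (p, z1) < F (p, z2)).
  { intros p z1 z2 Hp H1 H2 H12.
    apply Rabs_def2 in H1. apply Rabs_def2 in H2.
    destruct (MVT_gen (fun t => F (p, t)) z1 z2 (fun z => D (p, z) (zero, 1))) as (c & Hc & Ec).
    - rewrite Rmin_left, Rmax_right by lra. intros x Hx. apply Hr'; [exact Hp|apply Rabs_def1; lra].
    - rewrite Rmin_left, Rmax_right by lra. intros x Hx. apply cz; [exact Hp|apply Rabs_def1; lra].
    - rewrite Rmin_left, Rmax_right in Hc by lra.
      assert (0 < D (p, c) (zero, 1)) by (apply Hr'; [exact Hp|apply Rabs_def1; lra]).
      nra. }
  assert (uniq : forall p z1 z2, ball p0 r p -> Rabs (z1 - z0) < r -> Rabs (z2 - z0) < r ->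
      F (p, z1) = 0 -> F (p, z2) = 0 -> z1 = z2).
  { intros p z1 z2 Hp H1 H2 E1 E2.
    destruct (Rtotal_order z1 z2) as [L|[L|L]]; [|exact L|].
    - pose proof (mono _ _ _ Hp H1 H2 L). lra.
    - pose proof (mono _ _ _ Hp H2 H1 L). lra. }
  assert (cp : forall p z, ball p0 r p -> Rabs (z - z0) < r -> continuous (fun q => F (q, z)) p).
  { intros p z Hp Hz.
    apply (continuous_comp (fun q => (q, z)) F).
    - apply continuous_pair; [apply continuous_id|apply continuous_const].
    - apply (Ck_continuous 0 (V := V ** RN) (W := RN)). now apply Hr'. }
  pose (h := fun p => epsilon (inhabits 0) (fun z => Rabs (z - z0) < r /\ F (p, z) = 0)).
  pose proof (cond_pos r) as r0.
  assert (b0 : ball p0 r p0) by apply ball_center.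
  assert (W : locally p0 (fun p => ball p0 r p /\ Rabs (h p - z0) < r /\ F (p, h p) = 0)).
  { assert (A1 : Rabs (z0 + r / 2 - z0) < r) by (apply Rabs_def1; lra).
    assert (A2 : Rabs (z0 - r / 2 - z0) < r) by (apply Rabs_def1; lra).
    assert (A3 : Rabs (z0 - z0) < r) by (apply Rabs_def1; lra).
    assert (up : 0 < F (p0, z0 + r / 2)) by (rewrite <- F0; apply mono; auto; lra).
    assert (dn : F (p0, z0 - r / 2) < 0) by (rewrite <- F0; apply mono; auto; lra).
    pose proof (cp p0 (z0 + r / 2) b0 A1 _ (open_gt 0 _ up)) as up'.
    pose proof (cp p0 (z0 - r / 2) b0 A2 _ (open_lt 0 _ dn)) as dn'.
    unfold filtermap in up', dn'.
    generalize (filter_and _ _ (locally_ball p0 r) (filter_and _ _ up' dn')).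
    apply filter_imp. intros p (Hp & u & d).
    destruct (Ranalysis5.IVT_interv (fun t => F (p, t)) (z0 - r / 2) (z0 + r / 2)) as (z & Hz & Ez); auto.
    - intros a Ha. apply cz; [exact Hp|apply Rabs_def1; lra].
    - lra.
    - split; [exact Hp|].
      apply (epsilon_spec (inhabits 0) (fun z => Rabs (z - z0) < r /\ F (p, z) = 0)).
      exists z. split; [apply Rabs_def1; lra|exact Ez]. }
  exists h.
  assert (hz : h p0 = z0).
  { destruct (locally_singleton _ _ W) as (_ & a & b).
    apply (uniq p0); auto. apply Rabs_def1; lra. }
  assert (ch : locally p0 (continuous h)).
  { apply locally_locally in W. revert W. apply filter_imp. intros q W.
    destruct (locally_singleton _ _ W) as (Hq & a & b).
    apply Rabs_def2 in a.
    apply (proj2 (filterlim_locally h (h q))). intros eps.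
    pose (e := Rmin eps (Rmin (z0 + r - h q) (h q - (z0 - r))) / 2).
    assert (0 < Rmin eps (Rmin (z0 + r - h q) (h q - (z0 - r)))).
    { apply Rmin_pos; [apply cond_pos|]. apply Rmin_pos; lra. }
    assert (e0 : 0 < e) by (unfold e; lra).
    assert (e1 : e < eps).
    { pose proof (Rmin_l eps (Rmin (z0 + r - h q) (h q - (z0 - r)))). unfold e. lra. }
    assert (e2 : 2 * e <= z0 + r - h q /\ 2 * e <= h q - (z0 - r)).
    { pose proof (Rmin_r eps (Rmin (z0 + r - h q) (h q - (z0 - r)))).
      pose proof (Rmin_l (z0 + r - h q) (h q - (z0 - r))).
      pose proof (Rmin_r (z0 + r - h q) (h q - (z0 - r))). unfold e. lra. }
    assert (A0 : Rabs (h q - z0) < r) by (apply Rabs_def1; lra).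
    assert (A1 : Rabs (h q + e - z0) < r) by (apply Rabs_def1; lra).
    assert (A2 : Rabs (h q - e - z0) < r) by (apply Rabs_def1; lra).
    assert (up : 0 < F (q, h q + e)) by (rewrite <- b; apply mono; auto; lra).
    assert (dn : F (q, h q - e) < 0) by (rewrite <- b; apply mono; auto; lra).
    pose proof (cp q (h q + e) Hq A1 _ (open_gt 0 _ up)) as up'.
    pose proof (cp q (h q - e) Hq A2 _ (open_lt 0 _ dn)) as dn'.
    unfold filtermap in up', dn'.
    generalize (filter_and _ _ W (filter_and _ _ up' dn')).
    apply filter_imp. intros p ((Hp & u1 & u2) & u & d).
    change (Rabs (h p - h q) < eps).
    apply (Rlt_trans _ e); [|exact e1].
    apply Rabs_def1.
    - apply Rnot_le_lt. intros L.
      destruct (Rle_lt_or_eq_dec _ _ L) as [L'|L'].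
      + pose proof (mono p (h q + e) (h p) Hp A1 u1 ltac:(lra)). lra.
      + replace (h q + e) with (h p) in u by lra. lra.
    - apply Rnot_le_lt. intros L.
      destruct (Rle_lt_or_eq_dec _ _ L) as [L'|L'].
      + pose proof (mono p (h p) (h q - e) Hp u1 A2 ltac:(lra)). lra.
      + replace (h q - e) with (h p) in d by lra. lra. }
  split; [|split; [exact hz|]].
  - apply locally_locally in ch. apply locally_locally in W. unfold smooth_at.
    generalize (filter_and _ _ ch W). apply filter_imp. intros q [c w].
    destruct (locally_singleton _ _ w) as (Hq & a & b).
    apply (implicit_smooth_pt F h q (D (q, h q) (zero, 1))); auto.
    + now apply Hr'.
    + revert w. apply filter_imp. now intros x (_ & _ & w).
    + now apply Hr'.
    + apply Rgt_not_eq. now apply Hr'.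
  - assert (W' : locally (p0, z0) (fun w : V * R => (ball p0 r (fst w) /\
       Rabs (h (fst w) - z0) < r /\ F (fst w, h (fst w)) = 0) /\ Rabs (snd w - z0) < r)).
    { apply filter_and.
      - exact (continuous_fst p0 z0 _ W).
      - exact (continuous_snd p0 z0 _ (locally_ball z0 r)). }
    revert W'. apply filter_imp. intros [p z] ((Hp & a & b) & Hz). simpl in *. split.
    + intros E. now apply (uniq p).
    + intros ->. exact b.
Qed.

(** The equivalence in the conclusion contains existence and uniqueness of the
    solution; uniqueness is what makes the inverse maps below two-sided. *)
Lemma implicit_function {V : NM} (F : V * R -> R) (p0 : V) (z0 l : R) :
  smooth_at (V := V ** RN) (W := RN) F (p0, z0) ->
  F (p0, z0) = 0 -> is_derive (fun z => F (p0, z)) z0 l -> l <> 0 ->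
  exists h : V -> R, smooth_at (W := RN) h p0 /\ h p0 = z0 /\
    locally (p0, z0) (fun w => F w = 0 <-> snd w = h (fst w)).
Proof.
  intros HF F0 dl nz.
  destruct (Rlt_or_le 0 l) as [pos|neg].
  - now apply (implicit_function_pos F p0 z0 l).
  - destruct (implicit_function_pos (fun w => - F w) p0 z0 (- l)) as (h & a & b & c).
    + now apply (smooth_at_opp (V := V ** RN)).
    + lra.
    + apply (is_derive_opp (fun z => F (p0, z))). exact dl.
    + lra.
    + exists h. repeat split; auto. revert c. apply filter_imp. intros w. lra.
Qed.

(** * Hadamard's lemma *)

Definition in_box (r x y : R) : Prop := Rabs x < r /\ Rabs y < r.
Definition smooth_on_box (r : R) (f : R -> R -> R) : Prop :=
  forall x y, in_box r x y -> forall n, ex_diff_n f n x y.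

Lemma in_box_open r x y : in_box r x y -> locally_2d (in_box r) x y.
Proof.
  intros [Hx Hy].
  assert (H : 0 < Rmin (r - Rabs x) (r - Rabs y)) by (apply Rmin_pos; lra).
  exists (mkposreal _ H). simpl. intros u v Hu Hv.
  pose proof (Rmin_l (r - Rabs x) (r - Rabs y)).
  pose proof (Rmin_r (r - Rabs x) (r - Rabs y)).
  pose proof (Rabs_triang_inv u x). pose proof (Rabs_triang_inv v y).
  split; lra.
Qed.

Lemma in_box_shrink r x y t : in_box r x y -> 0 <= t <= 1 -> in_box r x (t * y).
Proof.
  intros [Hx Hy] Ht. split; [easy|].
  rewrite Rabs_mult, (Rabs_pos_eq t) by lra. pose proof (Rabs_pos y). nra.
Qed.

(** These integrals are stable under differentiation: a derivative in [x] keeps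
    [k] and one in [y] raises it by one.  For [k = 0] and [h = df/dy] the
    integral is the quotient of [f x y - f x 0] by [y]. *)
Definition moment (k : nat) (h : R -> R -> R) (x y : R) : R :=
  RInt (fun t => t ^ k * h x (t * y)) 0 1.

Lemma continuity_2d_moment_integrand k (h : R -> R -> R) x y t :
  continuity_2d_pt h x (t * y) ->
  continuity_2d_pt (fun u v => v ^ k * h u (v * y)) x t.
Proof.
  intros H. apply continuity_2d_pt_mult.
  - apply (continuity_1d_2d_pt_comp (fun v => v ^ k) (fun _ v => v)); [|apply continuity_2d_pt_id2].
    apply derivable_continuous, derivable_pow.
  - apply continuity_2d_pt_filterlim in H. apply continuity_2d_pt_filterlim.
    apply (continuous_comp_2 (U := prod_UniformSpace R_UniformSpace R_UniformSpace) (fun z : R * R => fst z) (fun z : R * R => snd z * y) h (x, t)).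
    + apply continuous_fst.
    + apply (continuous_scal_l (V := RN) (fun z : R * R => snd z) y). apply continuous_snd.
    + exact H.
Qed.

Lemma ex_RInt_moment r k h x y :
  (forall a b, in_box r a b -> continuity_2d_pt h a b) -> in_box r x y ->
  ex_RInt (fun t => t ^ k * h x (t * y)) 0 1.
Proof.
  intros Hh B. apply (ex_RInt_continuous (V := R_CompleteNormedModule)). intros t Ht.
  rewrite Rmin_left, Rmax_right in Ht by lra.
  apply (continuous_comp_2 (fun _ : R => x) (fun t => t) (fun u v => v ^ k * h u (v * y))).
  - apply continuous_const.
  - apply continuous_id.
  - apply (proj1 (continuity_2d_pt_filterlim (fun u v => v ^ k * h u (v * y)) x t)).
    apply continuity_2d_moment_integrand. apply Hh. now apply in_box_shrink.
Qed.

Lemma continuity_2d_moment r k h x y :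
  (forall a b, in_box r a b -> continuity_2d_pt h a b) -> in_box r x y ->
  continuity_2d_pt (moment k h) x y.
Proof.
  intros Hh B.
  pose (s := (r + Rmax (Rabs x) (Rabs y)) / 2).
  assert (Bx : Rabs x < s /\ Rabs y < s /\ s < r).
  { destruct B. pose proof (Rmax_l (Rabs x) (Rabs y)). pose proof (Rmax_r (Rabs x) (Rabs y)).
    assert (Rmax (Rabs x) (Rabs y) < r) by now apply Rmax_lub_lt. unfold s. lra. }
  destruct Bx as (Bx & By & Bs).
  intros eps.
  assert (e2 : 0 < eps / 2) by (pose proof (cond_pos eps); lra).
  destruct (uniform_continuity_2d h (-s) s (-s) s) with (eps := mkposreal _ e2) as [d Hd].
  { intros a b Ha Hb. apply Hh. split; apply Rabs_def1; lra. }
  simpl in Hd.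
  pose proof (in_box_open s x y (conj Bx By)) as O.
  assert (D : locally_2d (fun u v => Rabs (u - x) < d /\ Rabs (v - y) < d) x y) by now exists d.
  generalize (locally_2d_and _ _ x y O D). apply locally_2d_impl, locally_2d_forall.
  intros u v [[Bu Bv] [Du Dv]].
  unfold moment.
  assert (Iu : in_box r u v) by (split; lra).
  rewrite <- (RInt_minus (V := R_CompleteNormedModule)); try (now apply (ex_RInt_moment r)).
  apply (Rle_lt_trans _ ((1 - 0) * (eps / 2))); [|lra].
  apply abs_RInt_le_const; [lra| |].
  - apply (ex_RInt_minus (V := R_CompleteNormedModule)); now apply (ex_RInt_moment r).
  - intros t Ht. unfold minus, plus, opp; simpl.
    replace (t ^ k * h u (t * v) + - (t ^ k * h x (t * y)))
      with (t ^ k * (h u (t * v) - h x (t * y))) by ring.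
    rewrite Rabs_mult.
    assert (0 <= t ^ k <= 1).
    { split; [apply pow_le; lra|]. rewrite <- (pow1 k). apply pow_incr; lra. }
    rewrite (Rabs_pos_eq (t ^ k)) by lra.
    assert (K : Rabs (h u (t * v) - h x (t * y)) < eps / 2).
    { destruct (in_box_shrink s x y t (conj Bx By) Ht) as [_ b1].
      destruct (in_box_shrink s u v t (conj Bu Bv) Ht) as [_ b2].
      apply Rabs_def2 in Bx, Bu, b1, b2.
      apply Hd; try lra.
      - replace (t * v - t * y) with (t * (v - y)) by ring.
        rewrite Rabs_mult, (Rabs_pos_eq t) by lra. pose proof (Rabs_pos (v - y)). nra. }
    pose proof (Rabs_pos (h u (t * v) - h x (t * y))). nra.
Qed.

Lemma smooth_on_box_dx r h : smooth_on_box r h ->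
  smooth_on_box r (fun u v => Derive (fun z => h z v) u).
Proof. intros H x y B n. apply (H x y B (S n)). Qed.
Lemma smooth_on_box_dy r h : smooth_on_box r h ->
  smooth_on_box r (fun u v => Derive (fun z => h u z) v).
Proof. intros H x y B n. apply (H x y B (S n)). Qed.
Lemma smooth_on_box_cont r h : smooth_on_box r h ->
  forall x y, in_box r x y -> continuity_2d_pt h x y.
Proof. intros H x y B. apply (H x y B 0%nat). Qed.

Lemma locally_2d_slice_x (P : R -> R -> Prop) x y : locally_2d P x y -> locally x (fun z => P z y).
Proof. intros [d Hd]. exists d. intros z Hz. apply Hd; [exact Hz|].
  rewrite Rminus_diag, Rabs_R0. apply cond_pos. Qed.
Lemma locally_2d_slice_y (P : R -> R -> Prop) x y : locally_2d P x y -> locally y (fun z => P x z).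
Proof. intros [d Hd]. exists d. intros z Hz. apply Hd; [|exact Hz].
  rewrite Rminus_diag, Rabs_R0. apply cond_pos. Qed.

Lemma is_derive_moment_x r k h x y : smooth_on_box r h -> in_box r x y ->
  is_derive (fun z => moment k h z y) x (moment k (fun u v => Derive (fun z => h z v) u) x y).
Proof.
  intros H B. unfold moment.
  rewrite <- (RInt_ext (fun t => Derive (fun u => t ^ k * h u (t * y)) x)).
  2: { intros t _. apply Derive_scal. }
  pose proof (locally_2d_slice_x _ _ _ (in_box_open _ _ _ B)) as L.
  apply is_derive_RInt_param.
  - revert L. apply filter_imp. intros u Bu t Ht.
    rewrite Rmin_left, Rmax_right in Ht by lra.
    apply ex_derive_scal. apply (H u (t * y) (in_box_shrink _ _ _ _ Bu Ht) 1%nat).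
  - intros t Ht. rewrite Rmin_left, Rmax_right in Ht by lra.
    apply (continuity_2d_pt_ext (fun u v => v ^ k * Derive (fun z => h z (v * y)) u)).
    { intros u v. symmetry. apply Derive_scal. }
    apply (continuity_2d_moment_integrand k (fun u v => Derive (fun z => h z v) u)).
    apply (smooth_on_box_cont r); [now apply smooth_on_box_dx|now apply in_box_shrink].
  - revert L. apply filter_imp. intros u Bu. apply (ex_RInt_moment r); [|easy].
    now apply smooth_on_box_cont.
Qed.

Lemma is_derive_moment_y r k h x y : smooth_on_box r h -> in_box r x y ->
  is_derive (fun z => moment k h x z) y (moment (S k) (fun u v => Derive (fun z => h u z) v) x y).
Proof.
  intros H B. unfold moment.
  assert (E : forall u t, in_box r x (t * u) -> is_derive (fun z => t ^ k * h x (t * z)) u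
     (t ^ S k * Derive (fun z => h x z) (t * u))).
  { intros u t Bu.
    replace (t ^ S k * Derive (fun z => h x z) (t * u)) with
      (t ^ k * (t * Derive (fun z => h x z) (t * u))) by (simpl; ring).
    apply is_derive_scal.
    apply (is_derive_comp (fun z => h x z) (fun z => t * z)).
    - apply Derive_correct. apply (H x (t * u) Bu 1%nat).
    - auto_derive; [easy|ring]. }
  rewrite <- (RInt_ext (fun t => Derive (fun u => t ^ k * h x (t * u)) y)).
  2: { intros t Ht. rewrite Rmin_left, Rmax_right in Ht by lra.
       apply is_derive_unique, E. apply in_box_shrink; [easy|lra]. }
  pose proof (locally_2d_slice_y _ _ _ (in_box_open _ _ _ B)) as L.
  apply (is_derive_RInt_param (fun u t => t ^ k * h x (t * u))).
  - revert L. apply filter_imp. intros u Bu t Ht.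
    rewrite Rmin_left, Rmax_right in Ht by lra.
    eexists. apply E. now apply in_box_shrink.
  - intros t Ht. rewrite Rmin_left, Rmax_right in Ht by lra.
    assert (C : continuity_2d_pt (fun u v => v * u) y t).
    { apply continuity_2d_pt_mult; [apply continuity_2d_pt_id2|apply continuity_2d_pt_id1]. }
    apply (continuity_2d_pt_ext_loc (fun u v => v ^ S k * Derive (fun z => h x z) (v * u))).
    { assert (O : locally (t * y) (fun z => in_box r x z)).
      { apply (locally_2d_slice_y (in_box r)). apply in_box_open. now apply in_box_shrink. }
      destruct O as [e He]. specialize (C e).
      revert C. apply locally_2d_impl, locally_2d_forall. intros u v C.
      symmetry. apply is_derive_unique, E. apply He. exact C. }
    apply continuity_2d_pt_mult.
    + apply (continuity_1d_2d_pt_comp (fun v => v ^ S k) (fun _ v => v)); [|apply continuity_2d_pt_id2].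
      apply derivable_continuous, derivable_pow.
    + apply (continuity_1d_2d_pt_comp (fun w => Derive (fun z => h x z) w) (fun u v => v * u)); [|exact C].
      apply continuity_pt_filterlim.
      pose proof (smooth_on_box_cont r _ (smooth_on_box_dy r h H) x (t * y) (in_box_shrink _ _ _ _ B Ht)) as K.
      apply continuity_2d_pt_filterlim in K.
      apply (continuous_comp_2 (fun _ : R => x) (fun w => w) (fun u v => Derive (fun z => h u z) v)); [apply continuous_const|apply continuous_id|exact K].
  - revert L. apply filter_imp. intros u Bu. apply (ex_RInt_moment r); [|easy].
    now apply smooth_on_box_cont.
Qed.

Lemma smooth_on_box_moment r : forall k h, smooth_on_box r h -> smooth_on_box r (moment k h).
Proof.
  intros k h H x y B n. revert k h H x y B.
  induction n as [|n IH]; intros k h H x y B.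
  - split; [|easy]. apply (continuity_2d_moment r); [|easy]. now apply smooth_on_box_cont.
  - split; [|split; [|split; [|split]]].
    + apply (continuity_2d_moment r); [|easy]. now apply smooth_on_box_cont.
    + eexists. now apply (is_derive_moment_x r).
    + eexists. now apply (is_derive_moment_y r).
    + apply (ex_diff_n_ext_loc (moment k (fun u v => Derive (fun z => h z v) u))).
      * generalize (in_box_open _ _ _ B). apply locally_2d_impl, locally_2d_forall.
        intros u v Buv. symmetry. apply is_derive_unique. now apply (is_derive_moment_x r).
      * apply IH; [now apply smooth_on_box_dx|easy].
    + apply (ex_diff_n_ext_loc (moment (S k) (fun u v => Derive (fun z => h u z) v))).
      * generalize (in_box_open _ _ _ B). apply locally_2d_impl, locally_2d_forall.
        intros u v Buv. symmetry. apply is_derive_unique. now apply (is_derive_moment_y r).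
      * apply IH; [now apply smooth_on_box_dy|easy].
Qed.

(** The quotient is the average of [df/dy] over the segment from [(x, 0)] to
    [(x, y)], which remains smooth across [y = 0]. *)
Lemma hadamard_box r f : smooth_on_box r f ->
  exists q, smooth_on_box r q /\ forall x y, in_box r x y -> f x y = f x 0 + y * q x y.
Proof.
  intros H. exists (moment 0 (fun u v => Derive (fun z => f u z) v)).
  split; [now apply smooth_on_box_moment, smooth_on_box_dy|].
  intros x y B.
  assert (E : is_RInt (V := RN) (fun t => scal y (t ^ 0 * Derive (fun z => f x z) (t * y))) 0 1
                (minus (f x (1 * y)) (f x (0 * y)))).
  { apply (is_RInt_derive (fun t => f x (t * y))).
    - intros t Ht. rewrite Rmin_left, Rmax_right in Ht by lra.
      replace (scal y (t ^ 0 * Derive (fun z => f x z) (t * y)))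
        with (scal y (Derive (fun z => f x z) (t * y))) by (simpl; now rewrite Rmult_1_l).
      apply (is_derive_comp (fun z => f x z) (fun t => t * y)).
      + apply Derive_correct. apply (H x (t * y) (in_box_shrink _ _ _ _ B Ht) 1%nat).
      + auto_derive; [easy|ring].
    - intros t Ht. rewrite Rmin_left, Rmax_right in Ht by lra.
      apply (continuous_scal_r (V := RN)).
      pose proof (smooth_on_box_cont r _ (smooth_on_box_dy r f H) x (t * y) (in_box_shrink _ _ _ _ B Ht)) as K.
      apply (continuity_2d_moment_integrand 0 (fun u v => Derive (fun z => f u z) v)) in K.
      apply continuity_2d_pt_filterlim in K.
      apply (continuous_comp_2 (fun _ : R => x) (fun w => w) (fun u v => v ^ 0 * Derive (fun z => f u z) (v * y))); [apply continuous_const|apply continuous_id|exact K]. }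
  assert (F : y * moment 0 (fun u v => Derive (fun z => f u z) v) x y = f x (1 * y) - f x (0 * y)).
  { refine (eq_trans _ (is_RInt_unique _ _ _ _ E)). symmetry. unfold moment.
    apply (RInt_scal (V := R_CompleteNormedModule)).
    apply (ex_RInt_moment r 0 (fun u v => Derive (fun z => f u z) v)); [|easy].
    now apply smooth_on_box_cont, smooth_on_box_dy. }
  rewrite Rmult_1_l, Rmult_0_l in F. lra.
Qed.

Lemma hadamard_germ (f : R * R -> R) :
  smooth_at (V := RN ** RN) (W := RN) f (0, 0) ->
  exists q, smooth_at (V := RN ** RN) (W := RN) q (0, 0) /\
    locally (0, 0) (fun w => f w = f (fst w, 0) + snd w * q w).
Proof.
  intros H. apply smooth_fun_nearP in H. destruct H as [r Hr]. simpl in Hr.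
  destruct (hadamard_box r (fun x y => f (x, y))) as (q & Hq & E).
  { intros x y [Hx Hy] n. apply Hr; now rewrite Rminus_0_r. }
  exists (fun w => q (fst w) (snd w)). split.
  - apply smooth_fun_nearP. exists r. intros x y Hx Hy n. simpl in *.
    rewrite Rminus_0_r in Hx, Hy. apply Hq. now split.
  - exists r. intros [x y] [Hx Hy]. apply E. split; [rewrite <- (Rminus_0_r x)|rewrite <- (Rminus_0_r y)]; assumption.
Qed.

Lemma hadamard_interval (g : R -> R) (r : R) :
  (forall t, Rabs t < r -> smooth_pt (V := RN) (W := RN) g t) ->
  exists q : R -> R, (forall t, Rabs t < r -> smooth_pt (V := RN) (W := RN) q t) /\
    forall t, Rabs t < r -> g t = g 0 + t * q t.
Proof.
  intros H.
  destruct (hadamard_box r (fun _ y => g y)) as (q & Hq & E).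
  { intros x y [Hx Hy] n. apply smooth_pt_ex_diff_n. intros m.
    apply (Ck_comp m (V := RN ** RN) (W := RN) (X := RN) snd g); [|now apply H].
    apply Ck_linear, is_linear_snd. }
  exists (q 0).
  assert (B : forall t, Rabs t < r -> in_box r 0 t).
  { intros t Ht. split; [|easy]. rewrite Rabs_R0. pose proof (Rabs_pos t). lra. }
  split.
  - intros t Ht n.
    apply (Ck_comp n (V := RN) (W := RN ** RN) (X := RN) (fun y => (0, y)) (fun w => q (fst w) (snd w))).
    + apply (Ck_pair n (V := RN) (W := RN) (X := RN)); [apply Ck_const|apply Ck_linear, is_linear_id].
    + apply ex_diff_n_Ck. apply (locally_2d_locally (fun a b => forall m, ex_diff_n q m a b)).
      generalize (in_box_open _ _ _ (B t Ht)). apply locally_2d_impl, locally_2d_forall.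
      intros u v Buv m. now apply Hq.
  - intros t Ht. now apply (E 0 t), B.
Qed.

Lemma hadamard_germ_1d (g : R -> R) :
  smooth_at (V := RN) (W := RN) g 0 ->
  exists q : R -> R, smooth_at (V := RN) (W := RN) q 0 /\
    locally 0 (fun t => g t = g 0 + t * q t).
Proof.
  intros [r H].
  assert (B : forall t : R, ball 0 r t <-> Rabs t < r).
  { intros t. change (Rabs (t - 0) < r <-> Rabs t < r). now rewrite Rminus_0_r. }
  destruct (hadamard_interval g r) as (q & Hq & E).
  { intros t Ht. apply H. now apply B. }
  exists q. split; exists r; intros t Ht; [apply Hq|apply E]; now apply B.
Qed.

(** * Borel's theorem *)

(** A function together with all its derivatives. *)
Definition jet_on (U : R -> Prop) (G : nat -> R -> R) : Prop :=
  forall k s, U s -> is_derive (G k) s (G (S k) s).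

Lemma jet_smooth_pt (U : R -> Prop) G : open U -> jet_on U G ->
  forall k s, U s -> smooth_pt (V := RN) (W := RN) (G k) s.
Proof.
  intros oU H k s Us n. revert k s Us. induction n as [|n IH]; intros k s Us.
  - apply (ex_derive_continuous (G k) s). eexists. now apply H.
  - exists (fun q v => v * G (S k) q). split.
    + generalize (oU s Us). apply filter_imp. intros q Uq. now apply H.
    + intros v. apply (Ck_mult n (V := RN ** RN)).
      * apply Ck_linear, is_linear_snd.
      * apply (Ck_comp n (V := RN ** RN) (W := RN) fst (G (S k))); [|now apply IH].
        apply Ck_linear, is_linear_fst.
Qed.

Lemma mvt_bound (f df : R -> R) (t e : R) :
  (forall x, is_derive f x (df x)) -> f 0 = 0 -> Rabs t <= 1 ->
  (forall x, Rabs x <= 1 -> Rabs (df x) <= e) -> Rabs (f t) <= e.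
Proof.
  intros H f0 Ht B.
  destruct (MVT_gen f 0 t df) as (c & Hc & E).
  - intros; apply H.
  - intros x _. apply continuity_pt_filterlim, (ex_derive_continuous f). now eexists.
  - rewrite f0, !Rminus_0_r in E. rewrite E, Rabs_mult.
    assert (Rabs c <= 1).
    { apply Rabs_le. apply Rabs_le_between in Ht. revert Hc.
      unfold Rmin, Rmax. destruct (Rle_dec 0 t); lra. }
    pose proof (B c H0). pose proof (Rabs_pos t). pose proof (Rabs_pos (df c)). nra.
Qed.

(** A substitute for [c t^n / n!] whose derivatives of order below [n] are as
    small as desired on [[-1, 1]]: integrate [n] times [c cos (b t)] with [b]
    large; the first integration already gains the factor [/ b], and the next
    ones do not lose it on that interval. *)
Lemma small_monomial_jet (n : nat) (c eps : R) : 0 < eps ->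
  exists F : nat -> R -> R, jet_on (fun _ => True) F /\
    (forall j, (j < n)%nat -> F j 0 = 0) /\ F n 0 = c /\
    (forall j t, (j < n)%nat -> Rabs t <= 1 -> Rabs (F j t) <= eps).
Proof.
  intros He. destruct n as [|n].
  { exists (fun j _ => match j with O => c | _ => 0 end). split; [|split; [|split]].
    - intros k s _. destruct k; apply (is_derive_const (V := RN)).
    - intros j Hj; lia.
    - reflexivity.
    - intros j t Hj; lia. }
  induction n as [|n (F & J & Z & V & B)].
  - pose (b := Rabs c / eps + 1).
    assert (b1 : 1 <= b).
    { unfold b. pose proof (Rabs_pos c). assert (0 <= Rabs c / eps); [|lra].
      apply Rmult_le_pos; [easy|]. left. now apply Rinv_0_lt_compat. }
    (* the [j]-th derivative of [c / b * sin (b t)] *)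
    exists (fun j t => c / b * b ^ j * sin (b * t + INR j * (PI / 2))). split; [|split; [|split]].
    + intros k s _. rewrite S_INR.
      replace (b * s + (INR k + 1) * (PI / 2)) with ((b * s + INR k * (PI / 2)) + PI / 2) by ring.
      rewrite sin_plus, cos_PI2, sin_PI2. auto_derive; [easy|]. simpl. ring.
    + intros j Hj. replace j with 0%nat by lia. simpl. rewrite Rmult_0_r, Rmult_0_l, Rplus_0_l, sin_0. ring.
    + simpl. rewrite Rmult_0_r, Rplus_0_l, Rmult_1_l, sin_PI2. field. lra.
    + intros j t Hj _. replace j with 0%nat by lia. simpl (b ^ 0).
      rewrite Rmult_1_r, Rabs_mult.
      assert (Rabs (c / b) <= eps).
      { unfold Rdiv. rewrite Rabs_mult, Rabs_inv, (Rabs_pos_eq b) by lra.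
        apply (Rmult_le_reg_r b); [lra|]. rewrite Rmult_assoc, Rinv_l, Rmult_1_r by lra.
        unfold b. rewrite Rmult_plus_distr_l. unfold Rdiv.
        replace (eps * (Rabs c * / eps)) with (Rabs c) by (field; lra). lra. }
      assert (Rabs (sin (b * t + INR 0 * (PI / 2))) <= 1).
      { apply Rabs_le. apply SIN_bound. }
      pose proof (Rabs_pos (c / b)). pose proof (Rabs_pos (sin (b * t + INR 0 * (PI / 2)))). nra.
  - pose (P := fun t => RInt (F 0%nat) 0 t).
    assert (cF : forall t, continuous (F 0%nat) t).
    { intros t. apply (ex_derive_continuous (F 0%nat)). eexists. now apply J. }
    assert (dP : forall t, is_derive P t (F 0%nat t)).
    { intros t. apply (is_derive_RInt (F 0%nat) P 0); [|apply cF].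
      apply filter_forall. intros x. apply (RInt_correct (V := R_CompleteNormedModule)).
      apply (ex_RInt_continuous (V := R_CompleteNormedModule)). intros; apply cF. }
    assert (P0 : P 0 = 0) by apply (RInt_point (V := R_CompleteNormedModule)).
    exists (fun j => match j with O => P | S i => F i end). split; [|split; [|split]].
    + intros [|k] s _; [apply dP|now apply J].
    + intros [|j] Hj; [exact P0|apply Z; lia].
    + exact V.
    + intros [|j] t Hj Ht; [|apply B; [lia|easy]].
      apply (mvt_bound P (F 0%nat)); auto. intros x Hx. apply B; [lia|easy].
Qed.

Lemma jet_plus U F G : jet_on U F -> jet_on U G -> jet_on U (fun j t => F j t + G j t).
Proof. intros a b k s Us. apply (is_derive_plus (F k) (G k)); auto. Qed.

(** Borel's theorem: every sequence is the sequence of derivatives at [0] of a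
    smooth function.  Substitutes for the monomials are added one after the
    other, the [n]-th one correcting the [n]-th derivative at [0] without
    touching the previous ones, with bounds [2^-n] that make all the
    differentiated series converge uniformly. *)
Lemma borel (a : nat -> R) :
  exists B : nat -> R -> R, jet_on (fun t => Rabs t < 1) B /\ forall k, B k 0 = a k.
Proof.
  pose (T := fun n c => epsilon (inhabits (fun _ _ => 0))
    (fun F : nat -> R -> R => jet_on (fun _ => True) F /\
      (forall j, (j < n)%nat -> F j 0 = 0) /\ F n 0 = c /\
      (forall j t, (j < n)%nat -> Rabs t <= 1 -> Rabs (F j t) <= (/ 2) ^ n))).
  assert (HT : forall n c, jet_on (fun _ => True) (T n c) /\
      (forall j, (j < n)%nat -> T n c j 0 = 0) /\ T n c n 0 = c /\
      (forall j t, (j < n)%nat -> Rabs t <= 1 -> Rabs (T n c j t) <= (/ 2) ^ n)).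
  { intros n c. apply (epsilon_spec (inhabits (fun _ _ => 0))
      (fun F : nat -> R -> R => jet_on (fun _ => True) F /\
      (forall j, (j < n)%nat -> F j 0 = 0) /\ F n 0 = c /\
      (forall j t, (j < n)%nat -> Rabs t <= 1 -> Rabs (F j t) <= (/ 2) ^ n))).
    apply small_monomial_jet. apply pow_lt. lra. }
  clearbody T.
  pose (P := fix P (n : nat) : nat -> R -> R :=
    match n with
    | O => fun _ _ => 0
    | S m => fun j t => P m j t + T m (a m - P m m 0) j t
    end).
  assert (JP : forall n, jet_on (fun _ => True) (P n)).
  { induction n as [|n IH].
    - intros k s _. apply (is_derive_const (V := RN)).
    - apply jet_plus; [exact IH|apply HT]. }
  assert (VP : forall n j, (j < n)%nat -> P n j 0 = a j).
  { induction n as [|n IH]; intros j Hj; [lia|]. simpl.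
    destruct (HT n (a n - P n n 0)) as (_ & Z & V & _).
    destruct (Nat.eq_dec j n) as [->|ne].
    - rewrite V. ring.
    - rewrite Z, IH by lia. ring. }
  assert (CP : forall j n d t, (j < n)%nat -> Rabs t <= 1 ->
     Rabs (P (n + d)%nat j t - P n j t) <= 2 * (/ 2) ^ n - 2 * (/ 2) ^ (n + d)).
  { intros j n d t Hj Ht. induction d as [|d IH].
    - rewrite Nat.add_0_r, !Rminus_diag, Rabs_R0. lra.
    - rewrite Nat.add_succ_r. simpl.
      destruct (HT (n + d)%nat (a (n + d)%nat - P (n + d)%nat (n + d)%nat 0)) as (_ & _ & _ & B).
      specialize (B j t ltac:(lia) Ht).
      set (u := T (n + d)%nat _ j t) in *.
      replace (P (n + d)%nat j t + u - P n j t) with ((P (n + d)%nat j t - P n j t) + u) by ring.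
      apply (Rle_trans _ _ _ (Rabs_triang _ _)). lra. }
  pose (D := fun t => Rabs t < 1).
  assert (CU : forall j, CVU_dom (fun n => P n j) D).
  { intros j. apply CVU_dom_cauchy. intros eps.
    destruct (pow_lt_1_zero (/ 2)) with (y := eps / 4) as [N HN].
    { rewrite Rabs_pos_eq; lra. }
    { pose proof (cond_pos eps). lra. }
    exists (max N (S j)).
    assert (K : forall n m x, D x -> (max N (S j) <= n)%nat -> (n <= m)%nat ->
       Rabs (P m j x - P n j x) < eps / 2).
    { intros n m x Dx Hn Hm.
      replace m with (n + (m - n))%nat by lia.
      apply (Rle_lt_trans _ _ _ (CP j n (m - n)%nat x ltac:(lia) (Rlt_le _ _ Dx))).
      specialize (HN n ltac:(lia)).
      assert (p : forall i, 0 < (/ 2) ^ i) by (intros; apply pow_lt; lra).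
      pose proof (p (n + (m - n))%nat).
      rewrite Rabs_pos_eq in HN; [lra|]. left. apply p. }
    intros n m x Dx Hn Hm. pose proof (cond_pos eps).
    destruct (Nat.le_ge_cases n m) as [L|L].
    - rewrite Rabs_minus_sym. pose proof (K n m x Dx Hn L). lra.
    - pose proof (K m n x Dx Hm L). lra. }
  exists (fun j t => real (Lim_seq (fun n => P n j t))). split.
  - intros j t Dt.
    assert (DE : forall n i x, Derive (P n i) x = P n (S i) x).
    { intros. apply is_derive_unique. now apply JP. }
    rewrite <- (Lim_seq_ext (fun n => Derive (P n j) t)) by (intros; apply DE).
    apply (CVU_Derive (fun n => P n j) D).
    + intros x Dx. apply (locally_open (fun y : R => -1 < y /\ y < 1)).
      * apply open_and; [apply open_gt|apply open_lt].
      * intros y Hy. apply Rabs_def1; lra.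
      * apply Rabs_def2 in Dx. lra.
    + intros x y z Dx Dy Hz. apply Rabs_def2 in Dx, Dy. apply Rabs_def1; lra.
    + apply CU.
    + intros n x _. eexists. now apply JP.
    + intros n x _. apply (continuity_pt_ext (P n (S j))); [intros; now rewrite DE|].
      apply continuity_pt_filterlim, (ex_derive_continuous (P n (S j))). eexists. now apply JP.
    + intros eps. destruct (CU (S j) eps) as [N HN]. exists N. intros n Hn x Dx.
      rewrite DE, (Lim_seq_ext _ (fun n => P n (S j) x)) by (intros; apply DE). now apply HN.
    + exact Dt.
  - intros k. rewrite (Lim_seq_ext_loc _ (fun _ => a k)).
    + now rewrite Lim_seq_const.
    + exists (S k). intros n Hn. now apply VP.
Qed.

(** * Even functions: Whitney's theorem *)

Definition smooth_on_interval (r : R) (f : R -> R) : Prop :=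
  forall t, Rabs t < r -> smooth_pt (V := RN) (W := RN) f t.

Lemma smooth_on_interval_continuous r f t :
  smooth_on_interval r f -> Rabs t < r -> continuous f t.
Proof. intros H Ht. exact (H t Ht 0%nat). Qed.

Lemma smooth_on_interval_Derive r f : smooth_on_interval r f ->
  forall t, Rabs t < r -> is_derive f t (Derive f t).
Proof.
  intros H t Ht. destruct (H t Ht 1%nat) as (D & HD & _). apply locally_singleton in HD.
  apply Derive_correct. exists (D t 1).
  apply (is_derive_along (V := RN) (W := RN) f (D t) (fun x => x)); [exact HD|].
  apply (is_derive_id (K := R_AbsRing)).
Qed.

Lemma smooth_on_interval_deriv r f : smooth_on_interval r f -> smooth_on_interval r (Derive f).
Proof.
  intros H t Ht n. destruct (H t Ht (S n)) as (D & HD & HT).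
  apply (Ck_ext_loc n (V := RN) (W := RN) (fun q => D q 1)).
  - revert HD. apply filter_imp. intros q d. symmetry. apply is_derive_unique.
    apply (is_derive_along (V := RN) (W := RN) f (D q) (fun x => x)); [exact d|].
    apply (is_derive_id (K := R_AbsRing)).
  - apply (Ck_slice n (V := RN)). apply HT.
Qed.

Definition smooth_even (r : R) (f : R -> R) : Prop :=
  smooth_on_interval r f /\ forall t, Rabs t < r -> f (- t) = f t.

(** The derivative of an even function is odd, hence [x] times an even function.
    In terms of [s = x^2] this step is [d/ds]. *)
Lemma smooth_even_step r f : 0 < r -> smooth_even r f ->
  exists g, smooth_even r g /\ forall t, Rabs t < r -> is_derive f t (2 * t * g t).
Proof.
  intros r0 [Hf Ev].
  assert (odd : forall t, Rabs t < r -> Derive f (- t) = - Derive f t).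
  { intros t Ht.
    assert (d : is_derive (fun x => f (- x)) t (- Derive f (- t))).
    { replace (- Derive f (- t)) with ((-1) * Derive f (- t)) by ring.
      apply (is_derive_comp f Ropp).
      - apply (smooth_on_interval_Derive r); [easy|now rewrite Rabs_Ropp].
      - auto_derive; [easy|ring]. }
    assert (d' : is_derive f t (- Derive f (- t))).
    { apply (is_derive_ext_loc (fun x => f (- x))); [|exact d].
      assert (O : 0 < r - Rabs t) by lra.
      exists (mkposreal _ O). intros y Hy. apply Ev.
      change (Rabs (y - t) < r - Rabs t) in Hy.
      pose proof (Rabs_triang_inv y t). lra. }
    apply is_derive_unique in d'. lra. }
  destruct (hadamard_interval (Derive f) r) as (q & Hq & E).
  { now apply smooth_on_interval_deriv. }
  assert (d0 : Derive f 0 = 0).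
  { assert (K : Rabs 0 < r) by now rewrite Rabs_R0.
    pose proof (odd 0 K). rewrite Ropp_0 in H. lra. }
  exists (fun t => / 4 * (q t + q (- t))). split; [split|].
  - intros t Ht n. apply (Ck_mult n (V := RN)); [apply Ck_const|].
    apply (Ck_plus n (V := RN)); [now apply Hq|].
    apply (Ck_comp n (V := RN) (W := RN) (X := RN) Ropp q).
    + apply Ck_linear. exact (is_linear_opp (V := RN)).
    + apply Hq. now rewrite Rabs_Ropp.
  - intros t Ht. rewrite Ropp_involutive. ring.
  - intros t Ht.
    replace (2 * t * (/ 4 * (q t + q (- t)))) with (Derive f t).
    + now apply (smooth_on_interval_Derive r).
    + pose proof (E t Ht). pose proof (E (- t) ltac:(now rewrite Rabs_Ropp)).
      rewrite odd in H0 by easy. lra.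
Qed.

Lemma smooth_even_sequence r f : 0 < r -> smooth_even r f ->
  exists F : nat -> R -> R, F O = f /\ (forall k, smooth_even r (F k)) /\
    forall k t, Rabs t < r -> is_derive (F k) t (2 * t * F (S k) t).
Proof.
  intros r0 Hf.
  pose (N := fun s : {g | smooth_even r g} =>
    constructive_indefinite_description _
      (smooth_even_step r (proj1_sig s) r0 (proj2_sig s))).
  pose (step := fun s : {g | smooth_even r g} =>
     exist (smooth_even r) (proj1_sig (N s)) (proj1 (proj2_sig (N s)))).
  pose (F := fun k => Nat.iter k step (exist _ f Hf)).
  exists (fun k => proj1_sig (F k)). split; [easy|]. split.
  - intros k. apply (proj2_sig (F k)).
  - intros k t Ht. exact (proj2 (proj2_sig (N (F k))) t Ht).
Qed.

(** By the mean value theorem, a continuous function whose derivative away from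
    [s] has a limit at [s] is differentiable at [s]. *)
Lemma is_derive_from_sides (G dG : R -> R) (s e : R) : 0 < e ->
  (forall x, Rabs (x - s) < e -> continuous G x) ->
  (forall x, Rabs (x - s) < e -> x <> s -> is_derive G x (dG x)) ->
  continuous dG s ->
  is_derive G s (dG s).
Proof.
  intros e0 cG dd cd.
  apply is_derive_Reals. intros eps eps0.
  destruct (proj1 (filterlim_locally dG (dG s)) cd (mkposreal _ eps0)) as [d Hd].
  assert (m0 : 0 < Rmin d e) by (apply Rmin_pos; [apply cond_pos|easy]).
  exists (mkposreal _ m0). intros h hnz Hh. simpl in Hh.
  pose proof (Rmin_l d e). pose proof (Rmin_r d e).
  destruct (MVT_gen G s (s + h) dG) as (c & Hc & E).
  - intros x Hx. apply dd.
    + apply Rabs_def2 in Hh. revert Hx. unfold Rmin, Rmax.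
      destruct (Rle_dec s (s + h)); intros; apply Rabs_def1; lra.
    + revert Hx. unfold Rmin, Rmax. destruct (Rle_dec s (s + h)); intros; lra.
  - intros x Hx. apply continuity_pt_filterlim. apply cG.
    apply Rabs_def2 in Hh. revert Hx. unfold Rmin, Rmax.
    destruct (Rle_dec s (s + h)); intros; apply Rabs_def1; lra.
  - rewrite E. replace (s + h - s) with h by ring.
    replace (dG c * h / h - dG s) with (dG c - dG s) by (field; easy).
    apply Hd. change (Rabs (c - s) < d).
    apply Rabs_def2 in Hh. revert Hc. unfold Rmin, Rmax.
    destruct (Rle_dec s (s + h)); intros; apply Rabs_def1; lra.
Qed.

(** Whitney's theorem.  For [s >= 0] the function [g s = f (sqrt s)] has the
    successive derivatives [F k (sqrt s)] with [F (k+1) x = F k' x / (2 x)].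
    Towards negative [s] it is continued by a smooth function with the same
    derivatives at [0], which Borel's theorem provides. *)
Lemma even_function_of_square (r : R) (f : R -> R) : 0 < r -> smooth_even r f ->
  exists g : R -> R, smooth_at (V := RN) (W := RN) g 0 /\
    forall x, Rabs x < r -> f x = g (x ^ 2).
Proof.
  intros r0 Hf.
  destruct (smooth_even_sequence r f r0 Hf) as (F & F0 & HF & dF).
  destruct (borel (fun k => F k 0)) as (B & JB & B0).
  (* [neg s] is [min s 0], and [sqrt] vanishes on negative numbers: in [G k s]
     the first term is constant for [s <= 0] and the second for [s >= 0]. *)
  pose (neg := fun s => / 2 * (s - Rabs s)).
  pose (G := fun k s => F k (sqrt s) + (B k (neg s) - F k 0)).
  pose (rho := Rmin (r ^ 2) 1).
  assert (rho0 : 0 < rho) by (apply Rmin_pos; nra).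
  assert (rho1 : rho <= 1) by apply Rmin_r.
  assert (rho2 : rho <= r ^ 2) by apply Rmin_l.
  assert (sq : forall s, Rabs s < rho -> Rabs (sqrt s) < r).
  { intros s Hs. rewrite (Rabs_pos_eq (sqrt s)) by apply sqrt_pos.
    apply Rabs_def2 in Hs.
    destruct (Rle_lt_dec s 0) as [L|L].
    - rewrite sqrt_neg_0; lra.
    - rewrite <- (sqrt_pow2 r) by lra. apply sqrt_lt_1; nra. }
  assert (ng : forall s, Rabs s < rho -> Rabs (neg s) < 1).
  { intros s Hs. unfold neg. revert Hs. unfold Rabs at 1 3.
    destruct (Rcase_abs s); intros; apply Rabs_def1; lra. }
  assert (neg_pos : forall s, 0 <= s -> neg s = 0).
  { intros s Hs. unfold neg. rewrite Rabs_pos_eq by easy. ring. }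
  assert (neg_neg : forall s, s <= 0 -> neg s = s).
  { intros s Hs. unfold neg. rewrite Rabs_left1 by easy. field. }
  assert (Fc : forall k t, Rabs t < r -> continuous (F k) t).
  { intros k t Ht. apply (smooth_on_interval_continuous r); [apply HF|easy]. }
  assert (cG : forall k s, Rabs s < rho -> continuous (G k) s).
  { intros k s Hs. unfold G.
    apply (continuous_plus (V := RN) (fun s => F k (sqrt s)) (fun s => B k (neg s) - F k 0)).
    - apply (continuous_comp sqrt (F k)); [apply continuous_sqrt|]. now apply Fc, sq.
    - apply (continuous_minus (V := RN) (fun s => B k (neg s)) (fun _ => F k 0)); [|apply continuous_const].
      apply (continuous_comp neg (B k)).
      + apply (continuous_scal_r (V := RN) (/ 2) (fun s => s - Rabs s)).
        apply (continuous_minus (V := RN) (fun s => s) Rabs); [apply continuous_id|apply continuous_Rabs].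
      + apply (ex_derive_continuous (B k)). eexists. now apply JB, ng. }
  assert (JG : jet_on (fun s => Rabs s < rho) G).
  { assert (side : forall k s, Rabs s < rho -> s <> 0 -> is_derive (G k) s (G (S k) s)).
    { intros k s Hs ne. destruct (Rlt_or_le 0 s) as [L|L].
      - assert (s0 : 0 < sqrt s) by now apply sqrt_lt_R0.
        apply (is_derive_ext_loc (fun s => F k (sqrt s))).
        { generalize (open_gt 0 s L). apply filter_imp. intros u Hu. unfold G.
          rewrite neg_pos, B0 by lra. Rring. }
        unfold G. rewrite neg_pos, B0 by lra.
        replace (F (S k) (sqrt s) + (F (S k) 0 - F (S k) 0)) with
          ((1 / (2 * sqrt s)) * (2 * sqrt s * F (S k) (sqrt s))) by (field; lra).
        apply (is_derive_comp (F k) sqrt).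
        + now apply dF, sq.
        + apply (is_derive_sqrt (fun x => x)); [|easy]. apply (is_derive_id (K := R_AbsRing)).
      - assert (L' : s < 0) by lra.
        apply (is_derive_ext_loc (B k)).
        { generalize (open_lt 0 s L'). apply filter_imp. intros u Hu. unfold G.
          rewrite sqrt_neg_0, neg_neg by lra. Rring. }
        unfold G. rewrite sqrt_neg_0, neg_neg by lra.
        replace (F (S k) 0 + (B (S k) s - F (S k) 0)) with (B (S k) s) by ring.
        apply JB. lra. }
    intros k s Hs. destruct (Req_dec s 0) as [->|ne]; [|now apply side].
    apply (is_derive_from_sides _ _ 0 rho rho0).
    - intros x Hx. apply cG. now rewrite Rminus_0_r in Hx.
    - intros x Hx. apply side. now rewrite Rminus_0_r in Hx.
    - now apply cG. }
  exists (G O). split.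
  - exists (mkposreal _ rho0). intros s Hs.
    apply (jet_smooth_pt (fun s => Rabs s < rho) G).
    + intros t Ht. assert (O : 0 < rho - Rabs t) by lra.
      exists (mkposreal _ O). intros y Hy. change (Rabs (y - t) < rho - Rabs t) in Hy.
      pose proof (Rabs_triang_inv y t). lra.
    + exact JG.
    + change (Rabs (s - 0) < rho) in Hs. now rewrite Rminus_0_r in Hs.
  - intros x Hx. unfold G. rewrite neg_pos, B0 by nra.
    assert (E : sqrt (x ^ 2) = Rabs x) by (rewrite <- Rsqr_pow2; apply sqrt_Rsqr_abs).
    rewrite E, <- F0. destruct (Rcase_abs x) as [L|L].
    + rewrite Rabs_left by easy. destruct (HF O) as [_ ev]. rewrite ev by easy. ring.
    + rewrite Rabs_right by easy. ring.
Qed.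

Lemma even_odd_split (f : R -> R) : smooth_at (V := RN) (W := RN) f 0 ->
  exists a b : R -> R, smooth_at (V := RN) (W := RN) a 0 /\
    smooth_at (V := RN) (W := RN) b 0 /\
    locally 0 (fun x => f x = a (x ^ 2) + x * b (x ^ 2)).
Proof.
  intros [r H].
  assert (Hf : smooth_on_interval r f).
  { intros t Ht. apply H. change (Rabs (t - 0) < r). now rewrite Rminus_0_r. }
  assert (lin : forall n t, Ck n (V := RN) (W := RN) Ropp t).
  { intros. apply Ck_linear. exact (is_linear_opp (V := RN)). }
  assert (Hop : smooth_on_interval r (fun t => f (- t))).
  { intros t Ht n. apply (Ck_comp n (V := RN) (W := RN) (X := RN) Ropp f); [apply lin|].
    apply Hf. now rewrite Rabs_Ropp. }
  destruct (even_function_of_square r (fun t => / 2 * (f t + f (- t)))) as (a & Ha & Ea).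
  { apply cond_pos. }
  { split.
    - intros t Ht n. apply (Ck_mult n (V := RN)); [apply Ck_const|].
      apply (Ck_plus n (V := RN)); [now apply Hf|now apply Hop].
    - intros t Ht. rewrite Ropp_involutive. ring. }
  destruct (hadamard_interval (fun t => f t + (-1) * f (- t)) r) as (q & Hq & Eq).
  { intros t Ht n. apply (Ck_plus n (V := RN)); [now apply Hf|].
    apply (Ck_mult n (V := RN)); [apply Ck_const|now apply Hop]. }
  destruct (even_function_of_square r (fun t => / 4 * (q t + q (- t)))) as (b & Hb & Eb).
  { apply cond_pos. }
  { split.
    - intros t Ht n. apply (Ck_mult n (V := RN)); [apply Ck_const|].
      apply (Ck_plus n (V := RN)); [now apply Hq|].
      apply (Ck_comp n (V := RN) (W := RN) (X := RN) Ropp q); [apply lin|].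
      apply Hq. now rewrite Rabs_Ropp.
    - intros t Ht. rewrite Ropp_involutive. ring. }
  exists a, b. split; [easy|]. split; [easy|].
  exists r. intros x Hx. change (Rabs (x - 0) < r) in Hx. rewrite Rminus_0_r in Hx.
  rewrite <- Ea, <- Eb by easy.
  pose proof (Eq x Hx) as E1.
  pose proof (Eq (- x) ltac:(now rewrite Rabs_Ropp)) as E2.
  rewrite Ropp_0, Ropp_involutive in *. lra.
Qed.

(** * Inverse function theorems in one and two variables *)

Ltac smooth_step :=
  first [ assumption
        | apply smooth_at_const
        | apply smooth_at_id
        | apply smooth_at_plus | apply smooth_at_minus | apply smooth_at_mult
        | apply smooth_at_opp | apply smooth_at_pow | apply smooth_at_pair
        | apply smooth_at_linear; first [apply is_linear_fst | apply is_linear_snd]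
        | apply (smooth_at_fst (W := RN) (X := RN)) | apply (smooth_at_snd (W := RN) (X := RN))
        | apply (smooth_at_fst (W := R2) (X := RN)) | apply (smooth_at_snd (W := R2) (X := RN)) ].
Ltac smooth := repeat smooth_step.

Lemma near_comp {V W : UniformSpace} (f : V -> W) (p : V) (P : W -> Prop) :
  continuous f p -> locally (f p) P -> locally p (fun x => P (f x)).
Proof. intros Hf HP. exact (Hf P HP). Qed.

Lemma is_derive_mul_id (a : R -> R) :
  continuous a 0 -> is_derive (fun t => t * a t) 0 (a 0).
Proof.
  intros Ha. apply is_derive_Reals. intros eps eps0.
  destruct (proj1 (filterlim_locally a (a 0)) Ha (mkposreal _ eps0)) as [d Hd].
  exists d. intros h nz Hh. rewrite Rplus_0_l, Rmult_0_l, Rminus_0_r.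
  replace (h * a h / h) with (a h) by (field; easy).
  apply Hd. change (Rabs (h - 0) < d). now rewrite Rminus_0_r.
Qed.

Lemma inverse_germ_1d (c : R -> R) :
  smooth_at (V := RN) (W := RN) c 0 -> c 0 <> 0 ->
  exists m : R -> R, smooth_at (V := RN) (W := RN) m 0 /\ m 0 = 0 /\
    locally 0 (fun x => m x * c (m x) = x).
Proof.
  intros Hc nz.
  destruct (implicit_function (V := RN) (fun w : R * R => snd w * c (snd w) - fst w) 0 0 (c 0))
    as (m & Hm & m0 & E).
  - smooth. apply (smooth_at_comp (V := R2) (W := RN) (X := RN) snd c); smooth.
  - simpl. ring.
  - simpl. apply (is_derive_ext (fun t => t * c t)); [intros; simpl; Rring|].
    apply is_derive_mul_id. now apply (smooth_at_continuous (V := RN) (W := RN)).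
  - easy.
  - exists m. split; [easy|]. split; [easy|].
    assert (C : continuous (fun x : R => (x, m x)) 0).
    { apply continuous_pair; [apply continuous_id|]. now apply (smooth_at_continuous (V := RN) (W := RN)). }
    apply (near_comp (fun x : R => (x, m x)) 0
      (fun w : R * R => snd w * c (snd w) - fst w = 0 <-> snd w = m (fst w))) in C;
      [|rewrite m0; exact E].
    revert C. apply filter_imp. intros x Hx. simpl in Hx.
    assert (m x * c (m x) - x = 0) by now apply Hx. lra.
Qed.

Lemma local_diffeo_intro (f g : R * R -> R * R) (p q : R * R) :
  smooth_at (V := R2) (W := R2) f p -> f p = q ->
  smooth_at (V := R2) (W := R2) g q -> g q = p ->
  locally p (fun z : R * R => g (f z) = z) ->
  locally q (fun z : R * R => f (g z) = z) ->
  local_diffeo f p q.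
Proof.
  intros Hf Ef Hg Eg H1 H2. split; [split; [now apply smooth_nearP|easy]|].
  exists g. split; [split; [now apply smooth_nearP|easy]|]. now split.
Qed.

(** The inverse function theorem in the plane by two scalar implicit functions:
    solve the first equation for [x] as [xi (t, y)], then the second one,
    [f2 (xi (t, y), y) = s], for [y]; its derivative in [y] is the Jacobian
    divided by [a].  The map is given with factored components because that is
    how it arises; the linear part at the origin is then [(a, b; c, d)]. *)
Lemma inverse_germ_2d (f : R * R -> R * R) (a b c d : R * R -> R) :
  smooth_at (V := R2) (W := RN) a (0, 0) -> smooth_at (V := R2) (W := RN) b (0, 0) ->
  smooth_at (V := R2) (W := RN) c (0, 0) -> smooth_at (V := R2) (W := RN) d (0, 0) ->
  locally (0, 0) (fun z => f z = (fst z * a z + snd z * b z, fst z * c z + snd z * d z)) ->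
  a (0, 0) <> 0 -> a (0, 0) * d (0, 0) - b (0, 0) * c (0, 0) <> 0 ->
  local_diffeo f (0, 0) (0, 0).
Proof.
  intros Ha Hb Hc Hd Ef a0 det.
  pose (f1 := fun z => fst z * a z + snd z * b z).
  pose (f2 := fun z => fst z * c z + snd z * d z).
  assert (Hf1 : smooth_at (V := R2) (W := RN) f1 (0, 0)) by (unfold f1; smooth).
  assert (Hf2 : smooth_at (V := R2) (W := RN) f2 (0, 0)) by (unfold f2; smooth).
  assert (Hf : smooth_at (V := R2) (W := R2) f (0, 0)).
  { apply (smooth_at_ext (V := R2) (W := R2) (fun z => (f1 z, f2 z))); [|smooth].
    revert Ef. apply filter_imp. intros z ->. reflexivity. }
  assert (cont : forall (k : R * R -> R), smooth_at (V := R2) (W := RN) k (0, 0) ->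
     continuous k (0, 0)) by (intros k Hk; now apply (smooth_at_continuous (V := R2) (W := RN))).
  (* first coordinate *)
  destruct (implicit_function (V := R2)
     (fun w : (R * R) * R => f1 (snd w, snd (fst w)) - fst (fst w)) (0, 0) 0 (a (0, 0)))
    as (xi & Hxi & xi0 & Exi).
  { apply (smooth_at_minus (V := R2 ** RN)); [|smooth].
    apply (smooth_at_comp (V := R2 ** RN) (W := R2) (X := RN)
       (fun w => (snd w, snd (fst w))) f1); [smooth|exact Hf1]. }
  { unfold f1. simpl. ring. }
  { apply (is_derive_ext (fun t => t * a (t, 0))).
    { intros t. unfold f1. simpl. Rring. }
    apply (is_derive_mul_id (fun t => a (t, 0))).
    apply (continuous_comp (fun t : R => (t, 0)) a); [|now apply cont].
    apply continuous_pair; [apply continuous_id|apply continuous_const]. }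
  { exact a0. }
  simpl in Exi.
  (* at t = 0 *)
  assert (cxi : continuous (fun y : R => xi (0, y)) 0).
  { apply (continuous_comp (fun t : R => (0, t)) xi); [|now apply cont].
    apply continuous_pair; [apply continuous_const|apply continuous_id]. }
  assert (cxy : continuous (fun y : R => (xi (0, y), y)) 0).
  { apply continuous_pair; [exact cxi|apply continuous_id]. }
  assert (Cxy : forall k : R * R -> R, smooth_at (V := R2) (W := RN) k (0, 0) ->
      continuous (fun y : R => k (xi (0, y), y)) 0).
  { intros k Hk. apply (continuous_comp (fun y : R => (xi (0, y), y)) k); [exact cxy|].
    cbv beta. rewrite xi0. now apply cont. }
  destruct (implicit_function (V := R2)
     (fun w : (R * R) * R => f2 (xi (fst (fst w), snd w), snd w) - snd (fst w)) (0, 0) 0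
     (d (0, 0) + (- b (0, 0) / a (0, 0)) * c (0, 0)))
    as (eta & Heta & eta0 & Eeta).
  { apply (smooth_at_minus (V := R2 ** RN)); [|smooth].
    apply (smooth_at_comp (V := R2 ** RN) (W := R2) (X := RN)
       (fun w => (xi (fst (fst w), snd w), snd w)) f2).
    - smooth. apply (smooth_at_comp (V := R2 ** RN) (W := R2) (X := RN)
        (fun w => (fst (fst w), snd w)) xi); smooth.
    - simpl. rewrite xi0. exact Hf2. }
  { unfold f2. simpl. rewrite xi0. ring. }
  { assert (nzn : locally 0 (fun y : R => a (xi (0, y), y) <> 0)).
    { apply (near_comp (fun y : R => a (xi (0, y), y)) 0 (fun u => u <> 0)); [now apply Cxy|].
      apply open_neq. now rewrite xi0. }
    assert (En : locally 0 (fun y : R => f1 (xi (0, y), y) - 0 = 0 <-> xi (0, y) = xi (0, y))).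
    { apply (near_comp (fun y : R => ((0, y), xi (0, y))) 0
        (fun w : (R * R) * R => f1 (snd w, snd (fst w)) - fst (fst w) = 0 <-> snd w = xi (fst w))).
      - apply continuous_pair; [|exact cxi].
        apply continuous_pair; [apply continuous_const|apply continuous_id].
      - rewrite xi0. exact Exi. }
    apply (is_derive_ext_loc (fun y => y * (d (xi (0, y), y) + (- b (xi (0, y), y) / a (xi (0, y), y)) * c (xi (0, y), y)))).
    { assert (pt : forall y : R, a (xi (0, y), y) <> 0 -> f1 (xi (0, y), y) - 0 = 0 ->
        y * (d (xi (0, y), y) + (- b (xi (0, y), y) / a (xi (0, y), y)) * c (xi (0, y), y)) =
        f2 (xi (0, y), y) - 0).
      { intros y nz E. unfold f1 in E. unfold f2. simpl in *.
        set (A := a (xi (0, y), y)) in *. set (B := b (xi (0, y), y)) in *.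
        assert (X : xi (0, y) = - (y * B) / A).
        { apply (Rmult_eq_reg_r A); [|easy]. replace (- (y * B) / A * A) with (- (y * B)) by (field; easy). lra. }
        rewrite X. field. easy. }
      generalize (filter_and _ _ nzn En). apply filter_imp. intros y [nz [_ E]].
      apply pt; [exact nz|now apply E]. }
    assert (V0 : d (0, 0) + - b (0, 0) / a (0, 0) * c (0, 0) =
      (fun y : R => d (xi (0, y), y) + - b (xi (0, y), y) / a (xi (0, y), y) * c (xi (0, y), y)) 0).
    { cbv beta. now rewrite xi0. }
    rewrite V0. apply is_derive_mul_id.
    apply (continuous_plus (V := RN) (fun y => d (xi (0, y), y))); [now apply Cxy|].
    apply (continuous_mult (K := R_AbsRing) (fun y => - b (xi (0, y), y) / a (xi (0, y), y)));
      [|now apply Cxy].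
    apply (continuous_mult (K := R_AbsRing) (fun y => - b (xi (0, y), y)) (fun y => / a (xi (0, y), y))).
    - apply (continuous_opp (V := RN) (fun y => b (xi (0, y), y))). now apply Cxy.
    - apply continuous_Rinv_comp; [now apply Cxy|]. change (a (xi (0, 0), 0) <> 0). now rewrite xi0. }
  { intros K. apply det.
    replace (a (0, 0) * d (0, 0) - b (0, 0) * c (0, 0)) with
      (a (0, 0) * (d (0, 0) + - b (0, 0) / a (0, 0) * c (0, 0))) by (field; easy).
    rewrite K. ring. }
  simpl in Eeta.
  pose (g := fun z : R * R => (xi (fst z, eta z), eta z)).
  assert (Hg : smooth_at (V := R2) (W := R2) g (0, 0)).
  { unfold g. smooth. apply (smooth_at_comp (V := R2) (W := R2) (X := RN)
        (fun z => (fst z, eta z)) xi); [smooth|]. simpl. now rewrite eta0. }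
  assert (g0 : g (0, 0) = (0, 0)) by (unfold g; simpl; now rewrite eta0, xi0).
  assert (f0 : f (0, 0) = (0, 0)).
  { apply locally_singleton in Ef. rewrite Ef. simpl. f_equal; ring. }
  assert (cf : continuous f (0, 0)) by now apply (smooth_at_continuous (V := R2) (W := R2)).
  assert (cg : continuous g (0, 0)) by now apply (smooth_at_continuous (V := R2) (W := R2)).
  apply (local_diffeo_intro f g); auto.
  - assert (N1 : locally (0, 0) (fun z : R * R =>
       f1 (fst z, snd z) - fst (f z) = 0 <-> fst z = xi (fst (f z), snd z))).
    { apply (near_comp (fun z : R * R => ((fst (f z), snd z), fst z)) (0, 0)
        (fun w : (R * R) * R => f1 (snd w, snd (fst w)) - fst (fst w) = 0 <-> snd w = xi (fst w))).
      - apply continuous_pair; [apply continuous_pair|].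
        + apply (continuous_comp f fst); [exact cf|apply continuous_fst].
        + apply continuous_snd.
        + apply continuous_fst.
      - simpl. rewrite f0. exact Exi. }
    assert (N2 : locally (0, 0) (fun z : R * R =>
       f2 (xi (fst (f z), snd z), snd z) - snd (f z) = 0 <-> snd z = eta (f z))).
    { apply (near_comp (fun z : R * R => (f z, snd z)) (0, 0)
        (fun w : (R * R) * R => f2 (xi (fst (fst w), snd w), snd w) - snd (fst w) = 0 <-> snd w = eta (fst w))).
      - apply continuous_pair; [exact cf|apply continuous_snd].
      - simpl. rewrite f0. exact Eeta. }
    generalize (filter_and _ _ Ef (filter_and _ _ N1 N2)). apply filter_imp.
    intros [x y] (E & [E1 _] & [E2 _]). simpl in *.
    assert (Ex : x = xi (fst (f (x, y)), y)).
    { apply E1. rewrite E. unfold f1. simpl. ring. }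
    assert (Ey : y = eta (f (x, y))).
    { apply E2. rewrite <- Ex, E. unfold f2. simpl. ring. }
    unfold g. now rewrite <- Ey, <- Ex.
  - assert (N1 : locally (0, 0) (fun z : R * R =>
       f1 (g z) - fst z = 0)).
    { assert (K : locally (0, 0) (fun z : R * R => f1 (fst (g z), eta z) - fst z = 0 <-> fst (g z) = xi (fst z, eta z))).
      { apply (near_comp (fun z : R * R => ((fst z, eta z), fst (g z))) (0, 0)
        (fun w : (R * R) * R => f1 (snd w, snd (fst w)) - fst (fst w) = 0 <-> snd w = xi (fst w))).
        - apply continuous_pair; [apply continuous_pair|].
          + apply continuous_fst.
          + now apply cont.
          + apply (continuous_comp g fst); [exact cg|apply continuous_fst].
        - rewrite g0, eta0. exact Exi. }
      revert K. apply filter_imp. intros z [_ K]. now apply K. }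
    assert (N2 : locally (0, 0) (fun z : R * R => f2 (g z) - snd z = 0)).
    { assert (K : locally (0, 0) (fun z : R * R => f2 (xi (fst z, eta z), eta z) - snd z = 0 <-> eta z = eta z)).
      { apply (near_comp (fun z : R * R => (z, eta z)) (0, 0)
        (fun w : (R * R) * R => f2 (xi (fst (fst w), snd w), snd w) - snd (fst w) = 0 <-> snd w = eta (fst w))).
        - apply continuous_pair; [apply continuous_id|now apply cont].
        - rewrite eta0. exact Eeta. }
      revert K. apply filter_imp. intros z [_ K]. now apply K. }
    assert (N3 : locally (0, 0) (fun z : R * R => f (g z) = (f1 (g z), f2 (g z)))).
    { apply (near_comp g (0, 0) (fun z => f z = (f1 z, f2 z))); [exact cg|].
      rewrite g0. exact Ef. }
    generalize (filter_and _ _ N1 (filter_and _ _ N2 N3)). apply filter_imp.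
    intros [x y] (E1 & E2 & E3). simpl in *. rewrite E3. f_equal; lra.
Qed.

(** * Matching two cusps by a radial map *)

(** Division by the coordinate: the case [t = 0] follows by continuity. *)
Lemma cancel_id (w : R -> R) : continuous w 0 ->
  locally 0 (fun t => t * w t = 0) -> locally 0 (fun t => w t = 0).
Proof.
  intros cw H.
  assert (w0 : w 0 = 0).
  { apply NNPP. intros nz.
    pose proof (near_comp w 0 (fun u => u <> 0) cw (open_neq 0 _ nz)) as N.
    destruct (filter_and _ _ H N) as [d Hd].
    pose proof (cond_pos d).
    destruct (Hd (d / 2)) as [E1 E2].
    - change (Rabs (d / 2 - 0) < d). rewrite Rminus_0_r, Rabs_pos_eq; lra.
    - apply E2. apply Rmult_integral in E1. destruct E1; [lra|easy]. }
  revert H. apply filter_imp. intros t Ht.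
  destruct (Req_dec t 0) as [->|nz]; [exact w0|].
  apply Rmult_integral in Ht. destruct Ht; [contradiction|easy].
Qed.

Lemma cancel_id_at (w : R -> R) : continuous w 0 ->
  locally 0 (fun t => t * w t = 0) -> w 0 = 0.
Proof. intros a b. exact (locally_singleton _ _ (cancel_id w a b)). Qed.

(** A smooth function vanishing at the origin lies in the ideal generated by the
    coordinates; the values of the two factors at the origin are its partial
    derivatives there. *)
Lemma linear_factorization (f : R * R -> R) :
  smooth_at (V := R2) (W := RN) f (0, 0) -> f (0, 0) = 0 ->
  exists f1 f2 : R * R -> R,
    smooth_at (V := R2) (W := RN) f1 (0, 0) /\ smooth_at (V := R2) (W := RN) f2 (0, 0) /\
    locally (0, 0) (fun z => f z = fst z * f1 z + snd z * f2 z).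
Proof.
  intros Hf f0.
  destruct (hadamard_germ f Hf) as (q & Hq & Eq).
  destruct (hadamard_germ_1d (fun t => f (t, 0))) as (g & Hg & Eg).
  { apply (smooth_at_comp (V := RN) (W := R2) (X := RN) (fun t => (t, 0)) f); [smooth|exact Hf]. }
  exists (fun z => g (fst z)), q. split; [|split; [easy|]].
  - apply (smooth_at_comp (V := R2) (W := RN) (X := RN) fst g); [smooth|exact Hg].
  - pose proof (near_comp fst (0, 0) _ (continuous_fst 0 0) Eg) as Eg'.
    generalize (filter_and _ _ Eq Eg'). apply filter_imp. intros z [E1 E2].
    revert z E1 E2.
    assert (pt : forall z : R * R, f z = f (fst z, 0) + snd z * q z ->
      f (fst z, 0) = f (0, 0) + fst z * g (fst z) -> f z = fst z * g (fst z) + snd z * q z).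
    { intros z -> ->. rewrite f0. ring. }
    exact pt.
Qed.

(** The critical values of [standard_cusp]: it is singular along
    [y = - 3 x^2]. *)
Definition cuspidal (x : R) : R * R := (-2 * x ^ 3, -3 * x ^ 2).

Lemma smooth_cuspidal x : smooth_at (V := RN) (W := R2) cuspidal x.
Proof. unfold cuspidal. smooth. Qed.

Lemma cuspidal_0 : cuspidal 0 = (0, 0).
Proof. unfold cuspidal. f_equal; ring. Qed.

Lemma fst_cuspidal x : fst (cuspidal x) = -2 * x ^ 3.
Proof. reflexivity. Qed.
Lemma snd_cuspidal x : snd (cuspidal x) = -3 * x ^ 2.
Proof. reflexivity. Qed.

Lemma smooth_along_cuspidal (f : R * R -> R) :
  smooth_at (V := R2) (W := RN) f (0, 0) ->
  smooth_at (V := RN) (W := RN) (fun x => f (cuspidal x)) 0.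
Proof.
  intros H. apply (smooth_at_comp (V := RN) (W := R2) (X := RN) cuspidal f).
  - apply smooth_cuspidal.
  - now rewrite cuspidal_0.
Qed.

Lemma near_cuspidal (P : R * R -> Prop) :
  locally (0, 0) P -> locally 0 (fun x => P (cuspidal x)).
Proof.
  intros H. apply near_comp.
  - apply (smooth_at_continuous (V := RN) (W := R2)), smooth_cuspidal.
  - now rewrite cuspidal_0.
Qed.

(** Given a map [tau] tangent to the identity, there is a radial map
    [rho (u, w + l u)] sending the curve [cuspidal] to the curve
    [tau o cuspidal], up to the reparametrization [m].

    With [tau (cuspidal t) = (t^3 p t, t^2 q t)], the ray through this point is
    the image of the ray through [cuspidal x] exactly when
    [x = 3 t p / (2 (q - l t p))]; this is a local diffeomorphism of the line,
    of which [m] is the inverse.  The remaining condition prescribes the values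
    of [rho] on the cusp, namely [K x = - 4/27 (q - l t p)^3 / p^2] at
    [t = m x].  A smooth [rho] restricts on the cusp to a function of [x^2] and
    [x^3], so [K] must have no term of degree one: this is what the shear
    coefficient [l] is for.  Then [K x = 1 + x^2 a (x^2) + x^3 b (x^2)] by
    even-odd splitting, and [x^2 = - w / 3], [x^3 = - u / 2] on the cusp. *)
Lemma radial_matching (al be mu nu : R * R -> R) :
  smooth_at (V := R2) (W := RN) al (0, 0) -> smooth_at (V := R2) (W := RN) be (0, 0) ->
  smooth_at (V := R2) (W := RN) mu (0, 0) -> smooth_at (V := R2) (W := RN) nu (0, 0) ->
  al (0, 0) = 1 -> be (0, 0) = 0 -> mu (0, 0) = 0 -> nu (0, 0) = 1 ->
  exists (l : R) (rho : R * R -> R) (m n : R -> R),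
    smooth_at (V := R2) (W := RN) rho (0, 0) /\ rho (0, 0) = 1 /\
    smooth_at (V := RN) (W := RN) m 0 /\ smooth_at (V := RN) (W := RN) n 0 /\
    m 0 = 0 /\ n 0 = 1 /\ locally 0 (fun x => m x = x * n x) /\
    locally 0 (fun x =>
      let z := cuspidal (m x) in let y := cuspidal x in
      fst z * al z + snd z * be z = rho y * fst y /\
      fst z * mu z + snd z * nu z = rho y * (snd y + l * fst y)).
Proof.
  intros Hal Hbe Hmu Hnu al0 be0 mu0 nu0.
  destruct (linear_factorization be Hbe be0) as (be1 & be2 & Hbe1 & Hbe2 & Ebe).
  pose (p := fun t => -2 * al (cuspidal t) +
     t * (6 * t * be1 (cuspidal t) + 9 * be2 (cuspidal t))).
  pose (q := fun t => -2 * t * mu (cuspidal t) - 3 * nu (cuspidal t)).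
  pose proof (smooth_along_cuspidal al Hal). pose proof (smooth_along_cuspidal be1 Hbe1).
  pose proof (smooth_along_cuspidal be2 Hbe2).
  pose proof (smooth_along_cuspidal mu Hmu). pose proof (smooth_along_cuspidal nu Hnu).
  assert (Hp : smooth_at (V := RN) (W := RN) p 0) by (unfold p; smooth).
  assert (Hq : smooth_at (V := RN) (W := RN) q 0) by (unfold q; smooth).
  assert (p0 : p 0 = -2) by (unfold p; rewrite cuspidal_0, al0; ring).
  assert (q0 : q 0 = -3) by (unfold q; rewrite cuspidal_0, nu0; ring).
  destruct (hadamard_germ_1d p Hp) as (p1 & Hp1 & Ep1).
  destruct (hadamard_germ_1d q Hq) as (q1 & Hq1 & Eq1).
  (* the value for which [K] has no term of degree one *)
  pose (l := (p1 0 - q1 0) / 2).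
  pose (qh := fun t => q1 t - l * p t).
  assert (Hqh : smooth_at (V := RN) (W := RN) qh 0) by (unfold qh; smooth).
  destruct (hadamard_germ_1d (fun t => qh t - p1 t)) as (s & Hs & Es); [smooth|].
  assert (s0 : qh 0 - p1 0 = 0) by (unfold qh, l; rewrite p0; field).
  pose (Q := fun t => q t - l * t * p t).
  assert (HQ : smooth_at (V := RN) (W := RN) Q 0) by (unfold Q; smooth).
  assert (Q0 : Q 0 = -3) by (unfold Q; rewrite q0; ring).
  pose (c := fun t => 3 * p t / (2 * Q t)).
  assert (Hc : smooth_at (V := RN) (W := RN) c 0).
  { apply smooth_at_div; [smooth|smooth|]. rewrite Q0. lra. }
  assert (c0 : c 0 = 1) by (unfold c; rewrite p0, Q0; field).
  destruct (inverse_germ_1d c Hc) as (m & Hm & m0 & Em); [rewrite c0; lra|].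
  destruct (hadamard_germ_1d m Hm) as (n & Hn & En).
  assert (cm : continuous m 0) by now apply (smooth_at_continuous (V := RN) (W := RN)).
  assert (Hcm : smooth_at (V := RN) (W := RN) (fun x => c (m x)) 0).
  { apply (smooth_at_comp (V := RN) (W := RN) (X := RN) m c); [easy|]. now rewrite m0. }
  assert (n0 : n 0 = 1).
  { assert (K : n 0 * c (m 0) - 1 = 0).
    { apply (cancel_id_at (fun x => n x * c (m x) - 1)).
      - apply (smooth_at_continuous (V := RN) (W := RN)). smooth.
      - generalize (filter_and _ _ En Em). apply filter_imp. intros x [E1 E2].
        rewrite m0, Rplus_0_l in E1. rewrite E1 in E2 at 1. lra. }
    rewrite m0, c0 in K. lra. }
  (* [K = 1 + t^2 r2 t] in the parameter [t = m x] *)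
  pose (r2 := fun t => - (108 * s t - 36 * qh t ^ 2 + 4 * t * qh t ^ 3 + 27 * p1 t ^ 2) / (27 * p t ^ 2)).
  assert (Hr2 : smooth_at (V := RN) (W := RN) r2 0).
  { apply smooth_at_div; [smooth|smooth|]. rewrite p0. lra. }
  pose (K2 := fun x => n x ^ 2 * r2 (m x)).
  assert (HK2 : smooth_at (V := RN) (W := RN) K2 0).
  { assert (smooth_at (V := RN) (W := RN) (fun x => r2 (m x)) 0).
    { apply (smooth_at_comp (V := RN) (W := RN) (X := RN) m r2); [easy|]. now rewrite m0. }
    unfold K2. smooth. }
  destruct (even_odd_split K2 HK2) as (a & b & Ha & Hb & Eab).
  pose (rho := fun z => 1 + (- snd z / 3 * a (- snd z / 3) + (- fst z / 2) * b (- snd z / 3))).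
  assert (Hw : smooth_at (V := R2) (W := RN) (fun z => - snd z / 3) (0, 0)) by (unfold Rdiv; smooth).
  assert (comp_w : forall k : R -> R, smooth_at (V := RN) (W := RN) k 0 ->
    smooth_at (V := R2) (W := RN) (fun z => k (- snd z / 3)) (0, 0)).
  { intros k Hk. apply (smooth_at_comp (V := R2) (W := RN) (X := RN) (fun z => - snd z / 3) k); [exact Hw|].
    change (smooth_at (V := RN) (W := RN) k (- 0 / 3)).
    now replace (- 0 / 3) with 0 by field. }
  pose proof (comp_w a Ha). pose proof (comp_w b Hb).
  exists l, rho, m, n.
  split; [|split; [|split; [easy|split; [easy|split; [easy|split; [easy|split]]]]]].
  - unfold rho. smooth. unfold Rdiv. smooth.
  - unfold rho. simpl. field.
  - revert En. apply filter_imp. intros x ->. rewrite m0. ring.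
  - assert (pn : locally 0 (fun t => p t <> 0 /\ Q t <> 0)).
    { apply filter_and.
      - apply (near_comp p 0 (fun u => u <> 0)).
        + now apply (smooth_at_continuous (V := RN) (W := RN)).
        + apply open_neq. rewrite p0. lra.
      - apply (near_comp Q 0 (fun u => u <> 0)).
        + now apply (smooth_at_continuous (V := RN) (W := RN)).
        + apply open_neq. rewrite Q0. lra. }
    pose proof (filter_and _ _ (near_cuspidal _ Ebe) (filter_and _ _ pn
      (filter_and _ _ Ep1 (filter_and _ _ Eq1 Es)))) as N.
    rewrite <- m0 in N at 1.
    pose proof (near_comp m 0 _ cm N) as N'. clear N.
    generalize (filter_and _ _ N' (filter_and _ _ Em (filter_and _ _ En Eab))).
    apply filter_imp. clear N'.
    intros x ((Eb & [pnz Qnz] & E1 & E2 & E3) & Ex & Enx & Ek).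
    rewrite m0, Rplus_0_l in Enx. rewrite p0 in E1. rewrite q0 in E2. rewrite s0, Rplus_0_l in E3.
    set (t := m x) in *. cbv zeta.
    assert (F1 : fst (cuspidal t) * al (cuspidal t) + snd (cuspidal t) * be (cuspidal t) = t ^ 3 * p t).
    { change (be (cuspidal t) = -2 * t ^ 3 * be1 (cuspidal t) + -3 * t ^ 2 * be2 (cuspidal t)) in Eb.
      rewrite Eb. unfold p. rewrite fst_cuspidal, snd_cuspidal. ring. }
    assert (F2 : fst (cuspidal t) * mu (cuspidal t) + snd (cuspidal t) * nu (cuspidal t) = t ^ 2 * q t).
    { unfold q. rewrite fst_cuspidal, snd_cuspidal. ring. }
    rewrite F1, F2.
    assert (Er : rho (cuspidal x) = 1 + t ^ 2 * r2 t).
    { unfold rho. rewrite fst_cuspidal, snd_cuspidal.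
      replace (- (-3 * x ^ 2) / 3) with (x ^ 2) by field.
      replace (- (-2 * x ^ 3) / 2) with (x ^ 2 * x) by field.
      rewrite Rmult_assoc, <- Rmult_plus_distr_l, <- Ek. unfold K2. fold t.
      replace (t ^ 2) with (x ^ 2 * n x ^ 2) by (rewrite Enx; ring). ring. }
    (* [Q = -3 + t qh] and [p = -2 + t p1]: in [4 Q^3 + 27 p^2] the constant
       terms cancel and the linear term is [108 t (qh - p1) = 108 t^2 s]. *)
    assert (Er2 : rho (cuspidal x) = - (4 / 27) * Q t ^ 3 / p t ^ 2).
    { rewrite Er. unfold r2.
      assert (EQ : Q t = -3 + t * qh t) by (unfold Q, qh; rewrite E2; ring).
      replace (1 + t ^ 2 * (- (108 * s t - 36 * qh t ^ 2 + 4 * t * qh t ^ 3 + 27 * p1 t ^ 2) / (27 * p t ^ 2)))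
        with ((27 * p t ^ 2 - (t * 108 * (t * s t) + t ^ 2 * (- 36 * qh t ^ 2 + 4 * t * qh t ^ 3 + 27 * p1 t ^ 2))) / (27 * p t ^ 2))
        by (field; easy).
      rewrite <- E3, EQ.
      apply (Rmult_eq_reg_r (27 * p t ^ 2)).
      2: { apply Rmult_integral_contrapositive_currified; [lra|]. now apply pow_nonzero. }
      field_simplify; [|easy|easy].
      rewrite E1. ring. }
    rewrite Er2. unfold c in Ex. rewrite <- Ex.
    assert (Hq2 : q t = Q t + l * t * p t) by (unfold Q; ring).
    rewrite Hq2, fst_cuspidal, snd_cuspidal.
    split; field; easy.
Qed.

(** * Lifting maps that preserve the discriminant *)

(** [standard_cusp] in the coordinates [(x, e)] with [e = y + 3 x^2], which
    straighten its critical curve to [e = 0]. *)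
Definition fold_chart (z : R * R) : R * R :=
  (-2 * fst z ^ 3 + fst z * snd z, -3 * fst z ^ 2 + snd z).

Lemma smooth_fold_chart p : smooth_at (V := R2) (W := R2) fold_chart p.
Proof. unfold fold_chart. smooth. Qed.

Lemma fold_chart_axis x : fold_chart (x, 0) = cuspidal x.
Proof. unfold fold_chart, cuspidal. simpl. f_equal; ring. Qed.

Lemma smooth_at_filterdiff (f : R * R -> R) :
  smooth_at (V := R2) (W := RN) f (0, 0) ->
  locally (0, 0) (fun z => exists D : R * R -> R,
    filterdiff (U := R2) (V := RN) f (locally z) D).
Proof.
  unfold smooth_at. apply filter_imp. intros z H. destruct (H 1%nat) as (D & HD & _).
  exists (D z). exact (locally_singleton _ _ HD).
Qed.

(** The chart crosses the cusp in the tangent direction [(x, 1)], since the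
    velocity of [cuspidal] is [- 6 x (x, 1)].  So the derivative of [f] across
    the critical curve is determined by its values on the cusp. *)
Lemma fold_tangency (f : R * R -> R) (D : R * R -> R) (x : R) :
  filterdiff (U := R2) (V := RN) f (locally (cuspidal x)) D ->
  is_derive (fun e => f (fold_chart (x, e))) 0 (D (x, 1)) /\
  is_derive (fun t => f (cuspidal t)) x (-6 * x * D (x, 1)).
Proof.
  intros HD.
  assert (pairD : forall (u v : R -> R) (t du dv : R), is_derive u t du -> is_derive v t dv ->
     is_derive (V := R2) (fun s => (u s, v s)) t (du, dv)).
  { intros u v t du dv Hu Hv. unfold is_derive.
    apply (filterdiff_ext_lin _ (fun y : R => (scal y du, scal y dv))).
    - apply (filterdiff_pair (V := RN) (W := RN) (X := RN)); [exact Hu|exact Hv].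
    - intros y. reflexivity. }
  split.
  - apply (is_derive_along (V := R2) (W := RN) f D (fun e => fold_chart (x, e))).
    + now rewrite fold_chart_axis.
    + apply pairD; simpl; auto_derive; auto; ring.
  - replace (-6 * x * D (x, 1)) with (D (-6 * x ^ 2, -6 * x)).
    + apply (is_derive_along (V := R2) (W := RN) f D cuspidal); [exact HD|].
      apply pairD; auto_derive; auto; ring.
    + destruct HD as [lin _].
      replace (-6 * x ^ 2, -6 * x) with (scal (V := R2) (-6 * x) (x, 1)).
      * rewrite (linear_scal _ lin). reflexivity.
      * change ((-6 * x * x, -6 * x * 1) = (-6 * x ^ 2, -6 * x)). f_equal; ring.
Qed.

Lemma near_slice (P : R * R -> Prop) : locally (0, 0) P ->
  locally 0 (fun x : R => locally 0 (fun e : R => P (x, e))).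
Proof.
  intros H. apply locally_locally in H.
  assert (C : forall x e : R, continuous (fun t : R => (t, e)) x).
  { intros. apply continuous_pair; [apply continuous_id|apply continuous_const]. }
  assert (C' : forall x e : R, continuous (fun t : R => (x, t)) e).
  { intros. apply continuous_pair; [apply continuous_const|apply continuous_id]. }
  pose proof (near_comp (fun t : R => (t, 0)) 0 (fun z => locally z P) (C 0 0) H) as K.
  revert K. apply filter_imp. intros x K. exact (near_comp (fun t : R => (x, t)) 0 P (C' x 0) K).
Qed.

Lemma near_x_axis (P : R * R -> Prop) : locally (0, 0) P -> locally 0 (fun x : R => P (x, 0)).
Proof.
  intros H. apply (near_comp (fun t : R => (t, 0)) 0 P); [|exact H].
  apply continuous_pair; [apply continuous_id|apply continuous_const].
Qed.
Lemma near_y_axis (P : R * R -> Prop) : locally (0, 0) P -> locally 0 (fun x : R => P (0, x)).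
Proof.
  intros H. apply (near_comp (fun t : R => (0, t)) 0 P); [|exact H].
  apply continuous_pair; [apply continuous_const|apply continuous_id].
Qed.
Lemma near_fst (P : R -> Prop) : locally 0 P -> locally (0, 0) (fun z : R * R => P (fst z)).
Proof. intros H. exact (near_comp fst (0, 0) P (continuous_fst 0 0) H). Qed.

Lemma smooth_fst_comp (k : R -> R) (p : R * R) : smooth_at (V := RN) (W := RN) k (fst p) ->
  smooth_at (V := R2) (W := RN) (fun z => k (fst z)) p.
Proof. intros H. apply (smooth_at_comp (V := R2) (W := RN) (X := RN) fst k); [smooth|exact H]. Qed.

Lemma smooth_x_axis (k : R * R -> R) : smooth_at (V := R2) (W := RN) k (0, 0) ->
  smooth_at (V := RN) (W := RN) (fun x => k (x, 0)) 0.
Proof. intros H. apply (smooth_at_comp (V := RN) (W := R2) (X := RN) (fun x => (x, 0)) k); [smooth|exact H]. Qed.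
Lemma smooth_y_axis (k : R * R -> R) : smooth_at (V := R2) (W := RN) k (0, 0) ->
  smooth_at (V := RN) (W := RN) (fun x => k (0, x)) 0.
Proof. intros H. apply (smooth_at_comp (V := RN) (W := R2) (X := RN) (fun x => (0, x)) k); [smooth|exact H]. Qed.

Lemma hadamard_vanishing (f : R * R -> R) :
  smooth_at (V := R2) (W := RN) f (0, 0) -> locally 0 (fun x => f (x, 0) = 0) ->
  exists q, smooth_at (V := R2) (W := RN) q (0, 0) /\
    locally (0, 0) (fun z => f z = snd z * q z).
Proof.
  intros Hf H0. destruct (hadamard_germ f Hf) as (q & Hq & E).
  exists q. split; [exact Hq|].
  generalize (filter_and _ _ E (near_fst _ H0)). apply filter_imp.
  assert (pt : forall z : R * R, f z = f (fst z, 0) + snd z * q z /\ f (fst z, 0) = 0 ->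
    f z = snd z * q z) by (intros z [-> ->]; ring).
  exact pt.
Qed.

Lemma germ1_continuous (k : R -> R) x : smooth_at (V := RN) (W := RN) k x -> continuous k x.
Proof. apply (smooth_at_continuous (V := RN) (W := RN)). Qed.
Lemma germ2_continuous (k : R * R -> R) z : smooth_at (V := R2) (W := RN) k z -> continuous k z.
Proof. apply (smooth_at_continuous (V := R2) (W := RN)). Qed.

(** A map preserving the discriminant lifts through the cusp map.  A lift is
    [(X, P2)] with [X] a root of [X^3 + P2 X = P1], where [(P1, P2)] is [kappa]
    in the chart.  On the critical curve [e = 0] the cubic has the double root
    [m x], because [kappa] maps [cuspidal x] to [cuspidal (m x)].  Put
    [X = m x + e h]: since the value of the cubic at [m x] vanishes to second
    order in [e], everything is divisible by [e^2], and what remains is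
    [e h^3 + 3 m h^2 + g h - Q = 0] with [g <> 0], a simple equation for [h]. *)
Lemma cuspidal_lift (kappa : R * R -> R * R) (m n : R -> R) :
  smooth_at (V := R2) (W := R2) kappa (0, 0) ->
  smooth_at (V := RN) (W := RN) m 0 -> smooth_at (V := RN) (W := RN) n 0 ->
  m 0 = 0 -> n 0 = 1 -> locally 0 (fun x => m x = x * n x) ->
  locally 0 (fun x => kappa (cuspidal x) = cuspidal (m x)) ->
  exists sigma, local_diffeo sigma (0, 0) (0, 0) /\
    locally (0, 0) (fun z => standard_cusp (sigma z) = kappa (standard_cusp z)).
Proof.
  intros Hk Hm Hn m0 n0 Emn Ek.
  pose (k1 := fun z => fst (kappa z)). pose (k2 := fun z => snd (kappa z)).
  assert (Hk1 : smooth_at (V := R2) (W := RN) k1 (0, 0)) by now apply smooth_at_fst.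
  assert (Hk2 : smooth_at (V := R2) (W := RN) k2 (0, 0)) by now apply smooth_at_snd.
  assert (kap0 : kappa (0, 0) = (0, 0)).
  { pose proof (locally_singleton _ _ Ek) as E. cbv beta in E.
    rewrite cuspidal_0 in E. rewrite E, m0. apply cuspidal_0. }
  assert (k20 : k2 (0, 0) = 0) by (unfold k2; now rewrite kap0).
  assert (Ek1 : locally 0 (fun x => k1 (cuspidal x) = -2 * m x ^ 3)).
  { revert Ek. apply filter_imp. intros x E. unfold k1. rewrite E. reflexivity. }
  assert (Ek2 : locally 0 (fun x => k2 (cuspidal x) = -3 * m x ^ 2)).
  { revert Ek. apply filter_imp. intros x E. unfold k2. rewrite E. reflexivity. }
  (* [- 3 m^2 = - 2 x^3 k21 - 3 x^2 k22] on the cusp; divide by [x^2]. *)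
  destruct (linear_factorization k2 Hk2 k20) as (k21 & k22 & Hk21 & Hk22 & Ek2f).
  assert (k22_0 : k22 (0, 0) = 1).
  { pose proof (smooth_along_cuspidal k21 Hk21). pose proof (smooth_along_cuspidal k22 Hk22).
    assert (E : -3 * n 0 ^ 2 + 2 * 0 * k21 (cuspidal 0) + 3 * k22 (cuspidal 0) = 0).
    { apply (cancel_id_at (fun x => -3 * n x ^ 2 + 2 * x * k21 (cuspidal x) + 3 * k22 (cuspidal x))).
      { apply germ1_continuous. smooth. }
      apply (cancel_id (fun x => x * (-3 * n x ^ 2 + 2 * x * k21 (cuspidal x) + 3 * k22 (cuspidal x)))).
      { apply germ1_continuous. smooth. }
      generalize (filter_and _ _ Emn (filter_and _ _ Ek2 (near_cuspidal _ Ek2f))).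
      apply filter_imp. intros x (E1 & E2 & E3).
      change (k2 (cuspidal x) = -2 * x ^ 3 * k21 (cuspidal x) + -3 * x ^ 2 * k22 (cuspidal x)) in E3.
      rewrite E2, E1 in E3. 
      replace (x * (x * (-3 * n x ^ 2 + 2 * x * k21 (cuspidal x) + 3 * k22 (cuspidal x))))
        with (-3 * (x * n x) ^ 2 - (-2 * x ^ 3 * k21 (cuspidal x) + -3 * x ^ 2 * k22 (cuspidal x))) by ring.
      rewrite E3. ring. }
    rewrite cuspidal_0, n0 in E. lra. }
  pose (P1 := fun z => k1 (fold_chart z)). pose (P2 := fun z => k2 (fold_chart z)).
  assert (fc0 : fold_chart (0, 0) = (0, 0)) by (rewrite fold_chart_axis; apply cuspidal_0).
  assert (HP : forall k, smooth_at (V := R2) (W := RN) k (0, 0) ->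
     smooth_at (V := R2) (W := RN) (fun z => k (fold_chart z)) (0, 0)).
  { intros k H. apply (smooth_at_comp (V := R2) (W := R2) (X := RN) fold_chart k).
    - apply smooth_fold_chart.
    - now rewrite fc0. }
  assert (HP1 : smooth_at (V := R2) (W := RN) P1 (0, 0)) by now apply HP.
  assert (HP2 : smooth_at (V := R2) (W := RN) P2 (0, 0)) by now apply HP.
  assert (Hmf : smooth_at (V := R2) (W := RN) (fun z => m (fst z)) (0, 0)) by now apply smooth_fst_comp.
  assert (Hnf : smooth_at (V := R2) (W := RN) (fun z => n (fst z)) (0, 0)) by now apply smooth_fst_comp.
  destruct (hadamard_vanishing (fun z => P2 z + 3 * m (fst z) ^ 2)) as (g & Hg & Eg).
  { smooth. }
  { revert Ek2. apply filter_imp. intros x E. unfold P2. simpl fst.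
    rewrite fold_chart_axis, E. ring. }
  assert (g0 : g (0, 0) = 1).
  { enough (E : g (0, 0) - k22 (fold_chart (0, 0)) = 0) by (rewrite fc0, k22_0 in E; lra).
    apply (cancel_id_at (fun e => g (0, e) - k22 (fold_chart (0, e)))).
    { apply germ1_continuous. apply (smooth_y_axis (fun z => g z - k22 (fold_chart z))).
      pose proof (HP k22 Hk22). smooth. }
    assert (N : locally (0, 0) (fun z => k2 (fold_chart z) = fst (fold_chart z) * k21 (fold_chart z) + snd (fold_chart z) * k22 (fold_chart z))).
    { apply (near_comp fold_chart (0, 0) (fun z => k2 z = fst z * k21 z + snd z * k22 z)).
      - apply (smooth_at_continuous (V := R2) (W := R2)), smooth_fold_chart.
      - now rewrite fc0. }
    generalize (filter_and _ _ (near_y_axis _ Eg) (near_y_axis _ N)).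
    apply filter_imp. intros e [E1 E2].
    assert (pt : forall e : R, P2 (0, e) + 3 * m 0 ^ 2 = e * g (0, e) ->
       P2 (0, e) = (-2 * 0 ^ 3 + 0 * e) * k21 (fold_chart (0, e)) + (-3 * 0 ^ 2 + e) * k22 (fold_chart (0, e)) ->
       e * (g (0, e) - k22 (fold_chart (0, e))) = 0).
    { intros e' F1 F2. rewrite m0 in F1. rewrite F2 in F1. lra. }
    apply pt; [exact E1|exact E2]. }
  pose (Psi := fun z => P1 z - m (fst z) * P2 z - m (fst z) ^ 3).
  assert (HPsi : smooth_at (V := R2) (W := RN) Psi (0, 0)) by (unfold Psi; smooth).
  destruct (hadamard_vanishing Psi HPsi) as (Psi1 & HPsi1 & EPsi1).
  { generalize (filter_and _ _ Ek1 Ek2). apply filter_imp. intros x [E1 E2].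
    unfold Psi, P1, P2. simpl fst. rewrite fold_chart_axis, E1, E2. ring. }
  (* [Psi] is minus the value of the cubic at [m x].  Along the cusp the
     derivatives of [kappa] are those of [cuspidal (m x)], which cancel in the
     [e]-derivative of [Psi]. *)
  destruct (hadamard_vanishing Psi1 HPsi1) as (Q & HQ & EQ).
  { apply (cancel_id (fun x => Psi1 (x, 0))).
    { apply germ1_continuous, smooth_x_axis, HPsi1. }
    pose proof (near_cuspidal _ (filter_and _ _ (smooth_at_filterdiff k1 Hk1) (smooth_at_filterdiff k2 Hk2))) as D12.
    pose proof (smooth_at_near _ _ Hm) as Hm'.
    apply locally_locally in Ek1. apply locally_locally in Ek2.
    pose proof (near_slice _ EPsi1) as S1.
    pose proof (near_x_axis _ (smooth_at_near _ _ HPsi1)) as S2.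
    generalize (filter_and _ _ (filter_and _ _ D12 Hm')
       (filter_and _ _ (filter_and _ _ Ek1 Ek2) (filter_and _ _ S1 S2))).
    apply filter_imp. clear D12 Hm' Ek1 Ek2 S1 S2 Ek2f EPsi1 Ek Emn Eg.
    assert (pt : forall x : R,
      (exists D : R * R -> R, filterdiff (U := R2) (V := RN) k1 (locally (cuspidal x)) D) ->
      (exists D : R * R -> R, filterdiff (U := R2) (V := RN) k2 (locally (cuspidal x)) D) ->
      smooth_at (V := RN) (W := RN) m x ->
      locally x (fun x => k1 (cuspidal x) = -2 * m x ^ 3) ->
      locally x (fun x => k2 (cuspidal x) = -3 * m x ^ 2) ->
      locally 0 (fun e => Psi (x, e) = e * Psi1 (x, e)) ->
      smooth_at (V := R2) (W := RN) Psi1 (x, 0) ->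
      x * Psi1 (x, 0) = 0).
    { intros x [D1 HD1] [D2 HD2] Hmx F1 F2 FP HS.
      destruct (fold_tangency k1 D1 x HD1) as [d1 c1].
      destruct (fold_tangency k2 D2 x HD2) as [d2 c2].
      assert (exists m', is_derive m x m') as [m' dm].
      { destruct (smooth_at_pt _ _ Hmx 1%nat) as (D & HD & _).
        exists (D x 1).
        apply (is_derive_along (V := RN) (W := RN) m (D x) (fun x => x));
          [exact (locally_singleton _ _ HD)|]. apply (is_derive_id (K := R_AbsRing)). }
      assert (e1 : -6 * x * D1 (x, 1) = -6 * m x ^ 2 * m').
      { apply is_derive_unique in c1. refine (eq_trans (eq_sym c1) _).
        refine (eq_trans (Derive_ext_loc _ (fun x => -2 * m x ^ 3) _ F1) _). apply is_derive_unique.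
        auto_derive; [now exists m'|]. replace (Derive (fun x => m x) x) with m' by (symmetry; now apply is_derive_unique). ring. }
      assert (e2 : -6 * x * D2 (x, 1) = -6 * m x * m').
      { apply is_derive_unique in c2. refine (eq_trans (eq_sym c2) _).
        refine (eq_trans (Derive_ext_loc _ (fun x => -3 * m x ^ 2) _ F2) _). apply is_derive_unique.
        auto_derive; [now exists m'|]. replace (Derive (fun x => m x) x) with m' by (symmetry; now apply is_derive_unique). ring. }
      assert (e3 : Psi1 (x, 0) = D1 (x, 1) - m x * D2 (x, 1)).
      { assert (d3 : is_derive (fun e => Psi (x, e)) 0 (Psi1 (x, 0))).
        { apply (is_derive_ext_loc (fun e => e * Psi1 (x, e))).
          - revert FP. apply filter_imp. intros e E. symmetry. exact E.
          - apply (is_derive_mul_id (fun e => Psi1 (x, e))).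
            apply (continuous_comp (fun e : R => (x, e)) Psi1).
            + apply continuous_pair; [apply continuous_const|apply continuous_id].
            + now apply germ2_continuous. }
        assert (d4 : is_derive (fun e => Psi (x, e)) 0 (D1 (x, 1) - m x * D2 (x, 1) - 0)).
        { unfold Psi, P1, P2. simpl fst.
          apply (is_derive_minus (fun e => k1 (fold_chart (x, e)) - m x * k2 (fold_chart (x, e))) (fun _ => m x ^ 3)).
          - apply (is_derive_minus (fun e => k1 (fold_chart (x, e))) (fun e => m x * k2 (fold_chart (x, e)))); [exact d1|].
            apply is_derive_scal. exact d2.
          - apply (is_derive_const (V := RN)). }
        apply is_derive_unique in d3. apply is_derive_unique in d4.
        rewrite <- (Rminus_0_r (_ - _)). exact (eq_trans (eq_sym d3) d4). }
      rewrite e3.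
      assert (f1 : x * D1 (x, 1) = m x ^ 2 * m') by lra.
      assert (f2 : x * D2 (x, 1) = m x * m') by lra.
      replace (x * (D1 (x, 1) - m x * D2 (x, 1))) with (x * D1 (x, 1) - m x * (x * D2 (x, 1))) by ring.
      rewrite f1, f2. ring. }
    intros x (((a & b) & c) & ((d & e) & (f & h))). apply pt; assumption. }
  assert (EPsi : locally (0, 0) (fun z => Psi z = snd z ^ 2 * Q z)).
  { generalize (filter_and _ _ EPsi1 EQ). apply filter_imp.
    assert (pt : forall z : R * R, Psi z = snd z * Psi1 z /\ Psi1 z = snd z * Q z -> Psi z = snd z ^ 2 * Q z)
      by (intros z [-> ->]; ring).
    exact pt. }
  (* at the origin [m = 0], [e = 0] and [g = 1]: the equation reads [h = Q] *)
  destruct (implicit_function (V := R2)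
    (fun w : (R * R) * R => snd (fst w) * snd w ^ 3 + 3 * m (fst (fst w)) * snd w ^ 2
        + g (fst w) * snd w - Q (fst w)) (0, 0) (Q (0, 0)) 1) as (h & Hh & h0 & Eh).
  { assert (lift : forall k : R * R -> R, smooth_at (V := R2) (W := RN) k (0, 0) ->
      smooth_at (V := R2 ** RN) (W := RN) (fun w => k (fst w)) ((0, 0), Q (0, 0))).
    { intros k H. apply (smooth_at_comp (V := R2 ** RN) (W := R2) (X := RN) fst k); [smooth|exact H]. }
    pose proof (lift _ Hmf). pose proof (lift _ Hg). pose proof (lift _ HQ). cbv beta in *.
    smooth. }
  { simpl. rewrite m0, g0. ring. }
  { simpl. rewrite m0, g0. apply (is_derive_ext (fun t => t - Q (0, 0))).
    - intros t. simpl. Rring.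
    - auto_derive; [easy|ring]. }
  { lra. }
  assert (Ehz : locally (0, 0) (fun z : R * R => snd z * h z ^ 3 + 3 * m (fst z) * h z ^ 2
        + g z * h z - Q z = 0)).
  { assert (N : locally (0, 0) (fun z : R * R => snd z * h z ^ 3 + 3 * m (fst z) * h z ^ 2
        + g z * h z - Q z = 0 <-> h z = h z)).
    { apply (near_comp (fun z : R * R => (z, h z)) (0, 0) (fun w : (R * R) * R => snd (fst w) * snd w ^ 3 + 3 * m (fst (fst w)) * snd w ^ 2
        + g (fst w) * snd w - Q (fst w) = 0 <-> snd w = h (fst w))).
      - apply continuous_pair; [apply continuous_id|now apply germ2_continuous].
      - rewrite h0. exact Eh. }
    revert N. apply filter_imp. intros z [_ N]. now apply N. }
  pose (X := fun z => m (fst z) + snd z * h z).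
  assert (cubic : locally (0, 0) (fun z => X z ^ 3 + X z * P2 z = P1 z)).
  { generalize (filter_and _ _ Ehz (filter_and _ _ EPsi Eg)). apply filter_imp.
    assert (pt : forall z : R * R, snd z * h z ^ 3 + 3 * m (fst z) * h z ^ 2 + g z * h z - Q z = 0 /\
      Psi z = snd z ^ 2 * Q z /\ P2 z + 3 * m (fst z) ^ 2 = snd z * g z ->
      X z ^ 3 + X z * P2 z = P1 z).
    { intros z (E1 & E2 & E3). unfold X. unfold Psi in E2.
      assert (E4 : P1 z = snd z ^ 2 * Q z + m (fst z) * P2 z + m (fst z) ^ 3) by lra.
      assert (E5 : P2 z = snd z * g z - 3 * m (fst z) ^ 2) by lra.
      assert (E6 : Q z = snd z * h z ^ 3 + 3 * m (fst z) * h z ^ 2 + g z * h z) by lra.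
      rewrite E4, E5, E6. ring. }
    exact pt. }
  pose (chart := fun z : R * R => (fst z, snd z + 3 * fst z ^ 2)).
  assert (Hchart : smooth_at (V := R2) (W := R2) chart (0, 0)) by (unfold chart; smooth).
  assert (chart0 : chart (0, 0) = (0, 0)) by (unfold chart; simpl; f_equal; ring).
  assert (Nchart : forall P : R * R -> Prop, locally (0, 0) P -> locally (0, 0) (fun z => P (chart z))).
  { intros P HPz. apply near_comp; [now apply (smooth_at_continuous (V := R2) (W := R2))|].
    now rewrite chart0. }
  assert (Schart : forall k, smooth_at (V := R2) (W := RN) k (0, 0) ->
     smooth_at (V := R2) (W := RN) (fun z => k (chart z)) (0, 0)).
  { intros k H. apply (smooth_at_comp (V := R2) (W := R2) (X := RN) chart k); [exact Hchart|].
    now rewrite chart0. }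
  pose proof (Schart h Hh) as Hhc. pose proof (Schart g Hg) as Hgc.
  exists (fun z => (X (chart z), P2 (chart z))). split.
  - apply (inverse_germ_2d _ (fun z => n (fst z) + 3 * fst z * h (chart z))
      (fun z => h (chart z)) (fun z => -3 * fst z * n (fst z) ^ 2 + 3 * fst z * g (chart z))
      (fun z => g (chart z))).
    + smooth.
    + exact Hhc.
    + smooth.
    + exact Hgc.
    + generalize (filter_and _ _ (Nchart _ Eg) (near_fst _ Emn)). apply filter_imp.
      assert (pt : forall z : R * R, P2 (chart z) + 3 * m (fst z) ^ 2 = (snd z + 3 * fst z ^ 2) * g (chart z) /\
        m (fst z) = fst z * n (fst z) ->
        (X (chart z), P2 (chart z)) =
        (fst z * (n (fst z) + 3 * fst z * h (chart z)) + snd z * h (chart z),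
         fst z * (-3 * fst z * n (fst z) ^ 2 + 3 * fst z * g (chart z)) + snd z * g (chart z))).
      { intros z [E1 E2]. rewrite E2 in E1. f_equal.
        - unfold X. change (fst (chart z)) with (fst z). change (snd (chart z)) with (snd z + 3 * fst z ^ 2).
          rewrite E2. ring.
        - replace (P2 (chart z)) with ((snd z + 3 * fst z ^ 2) * g (chart z) - 3 * (fst z * n (fst z)) ^ 2) by lra.
          ring. }
      exact pt.
    + simpl fst. rewrite n0, chart0. lra.
    + simpl fst. rewrite n0, chart0, g0. lra.
  - generalize (Nchart _ cubic). apply filter_imp.
    assert (pt : forall z : R * R, X (chart z) ^ 3 + X (chart z) * P2 (chart z) = P1 (chart z) ->
      standard_cusp (X (chart z), P2 (chart z)) = kappa (standard_cusp z)).
    { intros z E. unfold standard_cusp at 1. simpl fst. simpl snd. rewrite E.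
      assert (F : fold_chart (chart z) = standard_cusp z).
      { unfold fold_chart, chart, standard_cusp. simpl. f_equal; ring. }
      unfold P1, P2, k1, k2. rewrite F. now destruct (kappa (standard_cusp z)). }
    exact pt.
Qed.

(** * Local diffeomorphisms and radial maps *)

Lemma local_diffeo_elim (f : R * R -> R * R) p q : local_diffeo f p q ->
  smooth_at (V := R2) (W := R2) f p /\ f p = q /\
  exists g : R * R -> R * R, smooth_at (V := R2) (W := R2) g q /\ g q = p /\
    locally p (fun z : R * R => g (f z) = z) /\ locally q (fun z : R * R => f (g z) = z).
Proof.
  intros [[Hf Ef] (g & [Hg Eg] & H1 & H2)].
  split; [now apply smooth_nearP|]. split; [easy|].
  exists g. split; [now apply smooth_nearP|]. now split.
Qed.

Lemma local_diffeo_comp (f g : R * R -> R * R) p q r :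
  local_diffeo f p q -> local_diffeo g q r -> local_diffeo (fun z => g (f z)) p r.
Proof.
  intros Hf Hg.
  destruct (local_diffeo_elim _ _ _ Hf) as (Sf & Ef & f' & Sf' & Ef' & F1 & F2).
  destruct (local_diffeo_elim _ _ _ Hg) as (Sg & Eg & g' & Sg' & Eg' & G1 & G2).
  assert (cont : forall (k : R * R -> R * R) z, smooth_at (V := R2) (W := R2) k z -> continuous k z)
    by (intros k z; apply (smooth_at_continuous (V := R2) (W := R2))).
  apply (local_diffeo_intro _ (fun z => f' (g' z))).
  - apply (smooth_at_comp (V := R2) (W := R2) (X := R2) f g); [easy|]. now rewrite Ef.
  - now rewrite Ef.
  - apply (smooth_at_comp (V := R2) (W := R2) (X := R2) g' f'); [easy|]. now rewrite Eg'.
  - now rewrite Eg'.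
  - assert (N : locally p (fun z : R * R => g' (g (f z)) = f z)).
    { apply (near_comp f p (fun z => g' (g z) = z)); [now apply cont|]. now rewrite Ef. }
    generalize (filter_and _ _ N F1). apply filter_imp. intros z [E1 E2]. now rewrite E1.
  - assert (N : locally r (fun z : R * R => f (f' (g' z)) = g' z)).
    { apply (near_comp g' r (fun z => f (f' z) = z)); [now apply cont|]. now rewrite Eg'. }
    generalize (filter_and _ _ N G2). apply filter_imp. intros z [E1 E2]. now rewrite E1.
Qed.

Lemma polar_angle (x y : R) : x ^ 2 + y ^ 2 = 1 -> exists t, x = cos t /\ y = sin t.
Proof.
  intros H.
  assert (B : -1 <= x <= 1) by nra.
  assert (S : sin (acos x) = Rabs y).
  { rewrite sin_acos by exact B. rewrite <- sqrt_Rsqr_abs. f_equal. unfold Rsqr. nra. }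
  destruct (Rle_lt_dec 0 y) as [L|L].
  - exists (acos x). rewrite cos_acos, S, Rabs_pos_eq by easy. easy.
  - exists (- acos x). rewrite cos_neg, sin_neg, cos_acos, S, Rabs_left by easy. split; ring.
Qed.

(** An invertible linear map permutes the rays and a positive factor preserves
    each of them. *)
Lemma scaled_linear_radial (rho : R * R -> R) (a b c d : R) (tau : R * R -> R * R) :
  continuous rho (0, 0) -> 0 < rho (0, 0) -> a * d - b * c <> 0 ->
  (forall z, tau z = (rho z * (a * fst z + b * snd z), rho z * (c * fst z + d * snd z))) ->
  exists eps : posreal, forall theta : R, exists theta' : R,
    forall z : C, on_ray theta z -> Cmod z < eps -> on_ray theta' (tau z).
Proof.
  intros cr r0 det E.
  destruct (near_comp rho (0, 0) (fun u => 0 < u) cr (open_gt 0 _ r0)) as [eps Heps].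
  exists eps. intros theta.
  pose (A := a * cos theta + b * sin theta). pose (B := c * cos theta + d * sin theta).
  assert (nz : 0 < A ^ 2 + B ^ 2).
  { destruct (Req_dec (A ^ 2 + B ^ 2) 0) as [Z|Z]; [|nra].
    assert (A = 0) by nra. assert (B = 0) by nra.
    pose proof (sin2_cos2 theta) as sc. unfold Rsqr in sc.
    assert ((a * d - b * c) * cos theta = 0).
    { replace ((a * d - b * c) * cos theta) with (d * A - b * B) by (unfold A, B; ring). nra. }
    assert ((a * d - b * c) * sin theta = 0).
    { replace ((a * d - b * c) * sin theta) with (a * B - c * A) by (unfold A, B; ring). nra. }
    apply Rmult_integral in H1, H2. destruct H1, H2; try contradiction. nra. }
  pose (N := sqrt (A ^ 2 + B ^ 2)).
  assert (N0 : 0 < N) by now apply sqrt_lt_R0.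
  assert (N2 : N ^ 2 = A ^ 2 + B ^ 2) by (apply pow2_sqrt; lra).
  destruct (polar_angle (A / N) (B / N)) as (theta' & Ec & Es).
  { replace ((A / N) ^ 2 + (B / N) ^ 2) with ((A ^ 2 + B ^ 2) / N ^ 2) by (field; lra).
    rewrite N2. field. lra. }
  exists theta'. intros z (r & rpos & Ez) Hz.
  assert (Hr : 0 < rho z).
  { apply Heps. destruct z as [u w].
    pose proof (Rmax_Cmod (u, w)) as M. simpl in M.
    split.
    - change (Rabs (u - 0) < eps). rewrite Rminus_0_r.
      pose proof (Rmax_l (Rabs u) (Rabs w)). lra.
    - change (Rabs (w - 0) < eps). rewrite Rminus_0_r.
      pose proof (Rmax_r (Rabs u) (Rabs w)). lra. }
  exists (rho z * r * N). split.
  - apply Rmult_lt_0_compat; [|easy]. now apply Rmult_lt_0_compat.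
  - rewrite E, <- Ec, <- Es. rewrite Ez at 2 3 5 6. simpl fst. simpl snd. unfold A, B.
    f_equal; field; lra.
Qed.

(** Substituting the factored inverse into [taui (tau z) = z] on the two axes and
    letting the point tend to the origin shows that the two linear parts are
    inverse matrices. *)
Lemma diffeo_linear_part (tau taui : R * R -> R * R) :
  smooth_at (V := R2) (W := R2) tau (0, 0) -> tau (0, 0) = (0, 0) ->
  smooth_at (V := R2) (W := R2) taui (0, 0) -> taui (0, 0) = (0, 0) ->
  locally (0, 0) (fun z : R * R => taui (tau z) = z) ->
  exists al be mu nu : R * R -> R,
    smooth_at (V := R2) (W := RN) al (0, 0) /\ smooth_at (V := R2) (W := RN) be (0, 0) /\
    smooth_at (V := R2) (W := RN) mu (0, 0) /\ smooth_at (V := R2) (W := RN) nu (0, 0) /\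
    al (0, 0) * nu (0, 0) - be (0, 0) * mu (0, 0) <> 0 /\
    locally (0, 0) (fun z : R * R =>
      tau z = (fst z * al z + snd z * be z, fst z * mu z + snd z * nu z)).
Proof.
  intros Ht t0 Hi i0 E.
  assert (F : forall f : R * R -> R * R, smooth_at (V := R2) (W := R2) f (0, 0) -> f (0, 0) = (0, 0) ->
    exists al be mu nu : R * R -> R,
    smooth_at (V := R2) (W := RN) al (0, 0) /\ smooth_at (V := R2) (W := RN) be (0, 0) /\
    smooth_at (V := R2) (W := RN) mu (0, 0) /\ smooth_at (V := R2) (W := RN) nu (0, 0) /\
    locally (0, 0) (fun z : R * R =>
      f z = (fst z * al z + snd z * be z, fst z * mu z + snd z * nu z))).
  { intros f Hf f0.
    destruct (linear_factorization (fun z => fst (f z))) as (al & be & Ha & Hb & E1).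
    { now apply smooth_at_fst. } { now rewrite f0. }
    destruct (linear_factorization (fun z => snd (f z))) as (mu & nu & Hm & Hn & E2).
    { now apply smooth_at_snd. } { now rewrite f0. }
    exists al, be, mu, nu. repeat (split; [assumption|]).
    generalize (filter_and _ _ E1 E2). apply filter_imp.
    assert (pt : forall z : R * R, fst (f z) = fst z * al z + snd z * be z /\
      snd (f z) = fst z * mu z + snd z * nu z ->
      f z = (fst z * al z + snd z * be z, fst z * mu z + snd z * nu z)).
    { intros z [<- <-]. now destruct (f z). }
    exact pt. }
  destruct (F tau Ht t0) as (al & be & mu & nu & Ha & Hb & Hm & Hn & Et).
  destruct (F taui Hi i0) as (al' & be' & mu' & nu' & Ha' & Hb' & Hm' & Hn' & Ei).
  exists al, be, mu, nu. repeat (split; [assumption|]). split; [|exact Et].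
  assert (Ct : forall k, smooth_at (V := R2) (W := RN) k (0, 0) ->
    smooth_at (V := R2) (W := RN) (fun z => k (tau z)) (0, 0)).
  { intros k H. apply (smooth_at_comp (V := R2) (W := R2) (X := RN) tau k); [easy|]. now rewrite t0. }
  assert (Ei' : locally (0, 0) (fun z : R * R => taui (tau z) =
    (fst (tau z) * al' (tau z) + snd (tau z) * be' (tau z), fst (tau z) * mu' (tau z) + snd (tau z) * nu' (tau z)))).
  { apply (near_comp tau (0, 0) (fun z => taui z = (fst z * al' z + snd z * be' z, fst z * mu' z + snd z * nu' z))).
    - now apply (smooth_at_continuous (V := R2) (W := R2)).
    - now rewrite t0. }
  pose proof (filter_and _ _ E (filter_and _ _ Et Ei')) as N.
  pose proof (Ct _ Ha'). pose proof (Ct _ Hb'). pose proof (Ct _ Hm'). pose proof (Ct _ Hn').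
  assert (e11 : al (0, 0) * al' (tau (0, 0)) + mu (0, 0) * be' (tau (0, 0)) - 1 = 0).
  { apply (cancel_id_at (fun t => al (t, 0) * al' (tau (t, 0)) + mu (t, 0) * be' (tau (t, 0)) - 1)).
    { apply germ1_continuous, (smooth_x_axis (fun z => al z * al' (tau z) + mu z * be' (tau z) - 1)). smooth. }
    generalize (near_x_axis _ N). apply filter_imp.
    assert (pt : forall t : R, taui (tau (t, 0)) = (t, 0) /\
      tau (t, 0) = (t * al (t, 0) + 0 * be (t, 0), t * mu (t, 0) + 0 * nu (t, 0)) /\
      taui (tau (t, 0)) = (fst (tau (t, 0)) * al' (tau (t, 0)) + snd (tau (t, 0)) * be' (tau (t, 0)),
                           fst (tau (t, 0)) * mu' (tau (t, 0)) + snd (tau (t, 0)) * nu' (tau (t, 0))) ->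
      t * (al (t, 0) * al' (tau (t, 0)) + mu (t, 0) * be' (tau (t, 0)) - 1) = 0).
    { intros t (E1 & E2 & E3). rewrite E1 in E3.
      apply (f_equal fst) in E3. simpl in E3. apply (f_equal fst) in E2 as E4. apply (f_equal snd) in E2 as E5.
      simpl in E4, E5. rewrite E4, E5 in E3. lra. }
    exact pt. }
  assert (e12 : al (0, 0) * mu' (tau (0, 0)) + mu (0, 0) * nu' (tau (0, 0)) = 0).
  { apply (cancel_id_at (fun t => al (t, 0) * mu' (tau (t, 0)) + mu (t, 0) * nu' (tau (t, 0)))).
    { apply germ1_continuous, (smooth_x_axis (fun z => al z * mu' (tau z) + mu z * nu' (tau z))). smooth. }
    generalize (near_x_axis _ N). apply filter_imp.
    assert (pt : forall t : R, taui (tau (t, 0)) = (t, 0) /\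
      tau (t, 0) = (t * al (t, 0) + 0 * be (t, 0), t * mu (t, 0) + 0 * nu (t, 0)) /\
      taui (tau (t, 0)) = (fst (tau (t, 0)) * al' (tau (t, 0)) + snd (tau (t, 0)) * be' (tau (t, 0)),
                           fst (tau (t, 0)) * mu' (tau (t, 0)) + snd (tau (t, 0)) * nu' (tau (t, 0))) ->
      t * (al (t, 0) * mu' (tau (t, 0)) + mu (t, 0) * nu' (tau (t, 0))) = 0).
    { intros t (E1 & E2 & E3). rewrite E1 in E3.
      apply (f_equal snd) in E3. simpl in E3. apply (f_equal fst) in E2 as E4. apply (f_equal snd) in E2 as E5.
      simpl in E4, E5. rewrite E4, E5 in E3. lra. }
    exact pt. }
  assert (e22 : be (0, 0) * mu' (tau (0, 0)) + nu (0, 0) * nu' (tau (0, 0)) - 1 = 0).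
  { apply (cancel_id_at (fun t => be (0, t) * mu' (tau (0, t)) + nu (0, t) * nu' (tau (0, t)) - 1)).
    { apply germ1_continuous, (smooth_y_axis (fun z => be z * mu' (tau z) + nu z * nu' (tau z) - 1)). smooth. }
    generalize (near_y_axis _ N). apply filter_imp.
    assert (pt : forall t : R, taui (tau (0, t)) = (0, t) /\
      tau (0, t) = (0 * al (0, t) + t * be (0, t), 0 * mu (0, t) + t * nu (0, t)) /\
      taui (tau (0, t)) = (fst (tau (0, t)) * al' (tau (0, t)) + snd (tau (0, t)) * be' (tau (0, t)),
                           fst (tau (0, t)) * mu' (tau (0, t)) + snd (tau (0, t)) * nu' (tau (0, t))) ->
      t * (be (0, t) * mu' (tau (0, t)) + nu (0, t) * nu' (tau (0, t)) - 1) = 0).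
    { intros t (E1 & E2 & E3). rewrite E1 in E3.
      apply (f_equal snd) in E3. simpl in E3. apply (f_equal fst) in E2 as E4. apply (f_equal snd) in E2 as E5.
      simpl in E4, E5. rewrite E4, E5 in E3. lra. }
    exact pt. }
  (* if the determinant vanished, [e12] and [e22] would give [a = c = 0] *)
  rewrite t0 in *. clear - e11 e12 e22. intros D.
  set (a := al _) in *. set (b := be _) in *. set (c := mu _) in *. set (d := nu _) in *.
  set (a' := al' _) in *. set (b' := be' _) in *. set (c' := mu' _) in *. set (d' := nu' _) in *.
  assert (one : b * c' + d * d' = 1) by lra.
  assert (az : a = 0).
  { rewrite <- (Rmult_1_r a), <- one.
    replace (a * (b * c' + d * d')) with (b * (a * c' + c * d') + d' * (a * d - b * c)) by ring.
    rewrite e12, D. ring. }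
  assert (cz : c = 0).
  { rewrite <- (Rmult_1_r c), <- one.
    replace (c * (b * c' + d * d')) with (d * (a * c' + c * d') - c' * (a * d - b * c)) by ring.
    rewrite e12, D. ring. }
  rewrite az, cz in e11. lra.
Qed.

Theorem proposition2p6 (psi : R * R -> C) (x0 y0 : R)
  (Hpsi : whitney_cusp psi (x0, y0)) :
  radially_equivalent psi (x0, y0) standard_cusp (0, 0).
Proof.
  destruct Hpsi as [_ (sigma1 & tau & Hs1 & Htau & Epsi)].
  destruct (local_diffeo_elim _ _ _ Htau) as (St & t0 & taui & Si & i0 & I1 & I2).
  destruct (diffeo_linear_part tau taui St t0 Si i0 I1)
    as (al & be & mu & nu & Ha & Hb & Hm & Hn & det & Et).
  pose (a := al (0, 0)). pose (b := be (0, 0)). pose (c := mu (0, 0)). pose (d := nu (0, 0)).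
  pose (dt := a * d - b * c).
  change (dt <> 0) in det.
  (* the factors of the map [A^-1 o tau], whose linear part is the identity *)
  destruct (radial_matching (fun z => (d * al z - b * mu z) / dt) (fun z => (d * be z - b * nu z) / dt)
     (fun z => (a * mu z - c * al z) / dt) (fun z => (a * nu z - c * be z) / dt))
    as (l & rho & m & n & Hrho & rho0 & Hmm & Hnn & m0 & n0 & Emn & matching).
  1-4: unfold Rdiv; smooth.
  1-4: fold a b c d; unfold dt; field; exact det.
  pose (T1 := fun z : R * R => (rho z * fst z, rho z * (snd z + l * fst z))).
  pose (A := fun z : R * R => (a * fst z + b * snd z, c * fst z + d * snd z)).
  assert (HA : local_diffeo A (0, 0) (0, 0)).
  { apply (local_diffeo_intro A (fun z => ((d * fst z - b * snd z) / dt, (a * snd z - c * fst z) / dt))).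
    - unfold A. smooth.
    - unfold A. simpl. f_equal; ring.
    - unfold Rdiv. smooth.
    - simpl. f_equal; field; exact det.
    - apply filter_forall. intros [u w]. unfold A. simpl. unfold dt. f_equal; Rfield; exact det.
    - apply filter_forall. intros [u w]. unfold A. simpl. unfold dt. f_equal; Rfield; exact det. }
  assert (HT1 : local_diffeo T1 (0, 0) (0, 0)).
  { apply (inverse_germ_2d T1 rho (fun _ => 0) (fun z => l * rho z) rho).
    - exact Hrho.
    - smooth.
    - smooth.
    - exact Hrho.
    - apply filter_forall.
      assert (pt : forall z : R * R, T1 z = (fst z * rho z + snd z * 0, fst z * (l * rho z) + snd z * rho z))
        by (intros z; unfold T1; f_equal; ring).
      exact pt.
    - rewrite rho0. lra.
    - rewrite rho0. lra. }
  pose (T := fun z => A (T1 z)).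
  assert (HT : local_diffeo T (0, 0) (0, 0)) by exact (local_diffeo_comp T1 A _ _ _ HT1 HA).
  destruct (local_diffeo_elim _ _ _ HT) as (ST & T0 & _).
  assert (cT : continuous T (0, 0)) by now apply (smooth_at_continuous (V := R2) (W := R2)).
  (* [T] and [tau] send the cusp to the same curve, so [kappa] preserves it *)
  pose (kappa := fun z => taui (T z)).
  destruct (cuspidal_lift kappa m n) as (sigma & Hsigma & Esigma); auto.
  { apply (smooth_at_comp (V := R2) (W := R2) (X := R2) T taui); [exact ST|]. now rewrite T0. }
  { pose proof (near_cuspidal _ (filter_and _ _ Et I1)) as N.
    assert (N' : locally 0 (fun x => tau (cuspidal (m x)) =
        (fst (cuspidal (m x)) * al (cuspidal (m x)) + snd (cuspidal (m x)) * be (cuspidal (m x)),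
         fst (cuspidal (m x)) * mu (cuspidal (m x)) + snd (cuspidal (m x)) * nu (cuspidal (m x))) /\
        taui (tau (cuspidal (m x))) = cuspidal (m x))).
    { apply (near_comp m 0 (fun t => tau (cuspidal t) =
        (fst (cuspidal t) * al (cuspidal t) + snd (cuspidal t) * be (cuspidal t),
         fst (cuspidal t) * mu (cuspidal t) + snd (cuspidal t) * nu (cuspidal t)) /\
        taui (tau (cuspidal t)) = cuspidal t)); [now apply germ1_continuous|].
      rewrite m0. exact N. }
    generalize (filter_and _ _ matching N'). apply filter_imp.
    intros x [[E1 E2] [E3 E4]]. unfold kappa. rewrite <- E4. f_equal.
    rewrite E3. unfold T, T1. cbv zeta in E1, E2. rewrite <- E1, <- E2.
    unfold A. simpl fst. simpl snd. unfold dt. f_equal; field; exact det. }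
  exists (fun z => sigma1 (sigma z)), T.
  split; [|split; [split; [exact HT|]|]].
  - exact (local_diffeo_comp sigma sigma1 _ _ _ Hsigma Hs1).
  - apply (scaled_linear_radial rho (a + b * l) b (c + d * l) d T).
    + now apply germ2_continuous.
    + rewrite rho0. lra.
    + intros Z. apply det. unfold dt. rewrite <- Z. ring.
    + intros z. unfold T, T1, A. simpl. f_equal; ring.
  - destruct (local_diffeo_elim _ _ _ Hsigma) as (Ss & s0 & _).
    assert (Sphi : smooth_at (V := R2) (W := R2) standard_cusp (0, 0)) by (unfold standard_cusp; smooth).
    assert (phi0 : standard_cusp (0, 0) = (0, 0)) by (unfold standard_cusp; simpl; f_equal; ring).
    assert (N1 : locally (0, 0) (fun z : R * R => psi (sigma1 (sigma z)) = tau (standard_cusp (sigma z)))).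
    { apply (near_comp sigma (0, 0) (fun z => psi (sigma1 z) = tau (standard_cusp z))).
      - now apply (smooth_at_continuous (V := R2) (W := R2)).
      - rewrite s0. exact Epsi. }
    assert (N2 : locally (0, 0) (fun z : R * R => tau (taui (T (standard_cusp z))) = T (standard_cusp z))).
    { apply (near_comp (fun z => T (standard_cusp z)) (0, 0) (fun z => tau (taui z) = z)).
      - apply (continuous_comp standard_cusp T).
        + now apply (smooth_at_continuous (V := R2) (W := R2)).
        + now rewrite phi0.
      - rewrite phi0, T0. exact I2. }
    generalize (filter_and _ _ N1 (filter_and _ _ N2 Esigma)). apply filter_imp.
    assert (pt : forall z : R * R, psi (sigma1 (sigma z)) = tau (standard_cusp (sigma z)) /\
      tau (taui (T (standard_cusp z))) = T (standard_cusp z) /\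
      standard_cusp (sigma z) = kappa (standard_cusp z) ->
      psi (sigma1 (sigma z)) = T (standard_cusp z)).
    { intros z (E1 & E2 & E3). rewrite E1, E3. exact E2. }
    exact pt.
Qed.
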